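(* Consider the linear model $Y=X\beta+\epsilon$ with fixed $n\times p$ design $X$, $n\le p$, $\epsilon\sim N(0,\sigma^2I_n)$, where each column of $X$ has $\ell_2$-norm at most $\sqrt n$. Suppose condition $RE(s,s,3,X)$ holds and write $K=K(s,s,3,X)$. Let $\lambda_{\mathrm{init}}=\sqrt{24}\,\sigma\sqrt{\log p/n}$, let $\beta_{\mathrm{init}}=\arg\min_{b}\frac1{2n}\|Y-Xb\|_2^2+\lambda_{\mathrm{init}}\|b\|_1$, and let $\bar s=|\{j:|\beta_{j,\mathrm{init}}|>4\lambda_{\mathrm{init}}\}|$. Suppose that on $\mathcal{T}$, for some $0<\eta<1$ and some constant $M$ with $$\frac{4K}{\eta}\le M\le\frac{\sqrt{\Lambda_{\min}(s)}}{(1-\eta)\sigma}\sqrt{\frac{n}{2\log p}},$$ $\lambda_n$ is chosen such that $$16MK\ \ge\ \frac{\lambda_n}{\sigma\lambda_{\mathrm{init}}\sqrt{\bar s}}\sqrt{\frac{n}{2\log(p-s)}}\ \ge\ \frac{64K^2}{\eta}.$$ Let $\tilde r_n\ge r_n(S)$ be an upper bound. Suppose $$s<\frac{n}{96\,\sigma^2K^2\log p},\qquad \tilde r_n\sqrt s\le\frac{1-\eta}{32K^2\lambda_{\mathrm{init}}},$$ and $$\beta_{\min}>\max\left\{\frac{2\tilde r_n}{1-\eta},\frac{M}{\sqrt3}\right\}16K^2\lambda_{\mathrm{init}}\sqrt s.$$ Then, with probability at least $1-2/p^2$, the adaptive Lasso estimator $\hat\beta=\arg\min_b\frac1{2n}\|Y-Xb\|_2^2+\lambda_n\sum_{j=1}^pw_j|b_j|$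 with weights $w_j=\max\{1/|\beta_{j,\mathrm{init}}|,1\}$ satisfies $\mathrm{supp}(\hat\beta)=\mathrm{supp}(\beta)$.
   Context: $S:=\mathrm{supp}(\beta)=\{j:\beta_j\ne0\}$, $s:=|S|$, $\beta_{\min}:=\min_{j\in S}|\beta_j|$, $S^c$ the complement; $\gamma_J$ and $X_J$ denote the subvector and column-submatrix indexed by $J$. If $\beta_{j,\mathrm{init}}=0$ then $w_j=\infty$, meaning the $j$-th coordinate is constrained to be $0$. $r_n(S):=\|X_{S^c}^TX_S(X_S^TX_S)^{-1}\|_\infty$, where for a $k\times m$ matrix $\|A\|_\infty=\max_i\sum_j|A_{ij}|$. $\mathcal{T}:=\left\{\|X^T\epsilon/n\|_\infty\le\sigma\sqrt{6\log p/n}\right\}$ ($\|\cdot\|_\infty$ = maximum absolute entry of a vector). $\Lambda_{\min}(s):=\min_{J_0\subseteq\{1,\dots,p\},|J_0|\le s}\ \min_{\gamma\ne0,\ \gamma_{J_0^c}=0}\frac{\|X\gamma\|_2^2}{n\|\gamma_{J_0}\|_2^2}$. Condition $RE(s,m,k_0,X)$ (integers $1\le s\le p/2$, $m\ge s$, $s+m\le p$, $k_0>0$) states $\frac{1}{K(s,m,k_0,X)}:=\min_{J_0\subseteq\{1,\dots,p\},|J_0|\le s}\ \min_{\gamma\neq0,\ \|\gamma_{J_0^c}\|_1\le k_0\|\gamma_{J_0}\|_1}\frac{\|X\gamma\|_2}{\sqrt n\,\|\gamma_{J_{0m}}\|_2}>0$, where $J_{0m}=J_0\cup J_m$ and $J_m$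 is the set of the $m$ coordinates of $\gamma$ outside $J_0$ that are largest in absolute value. *)

(* Defs.v *)
From mathcomp Require Export all_boot all_order all_algebra.
From mathcomp Require Export all_classical all_reals all_analysis.
Export Order.TTheory GRing.Theory Num.Theory numFieldNormedType.Exports.
Set Implicit Arguments.
Unset Strict Implicit.
Unset Printing Implicit Defensive.
Local Open Scope classical_set_scope.
Local Open Scope ring_scope.

(* Vectors are column matrices 'cV[R]_k. The norm `|v| which
   MathComp-Analysis puts on matrices is the maximum absolute entry. *)
Definition l1norm (R : realType) (k : nat) (v : 'cV[R]_k) : R :=
  \sum_(i < k) `|v i ord0|.

Definition l2norm (R : realType) (k : nat) (v : 'cV[R]_k) : R :=
  Num.sqrt (\sum_(i < k) v i ord0 ^+ 2).

(* The induced l_oo -> l_oo operator norm, not the entrywise maximum `|A|. *)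
Definition max_row_sum (R : realType) (k m : nat) (A : 'M[R]_(k, m)) : R :=
  \big[Num.max/0]_(i < k) \sum_(j < m) `|A i j|.

Definition subvec (R : realType) (p : nat) (J : {set 'I_p}) (v : 'cV[R]_p) :
    'cV[R]_#|J| :=
  rowsub (fun k : 'I_#|J| => enum_val k) v.

Definition subcols (R : realType) (n p : nat) (J : {set 'I_p})
    (X : 'M[R]_(n, p)) : 'M[R]_(n, #|J|) :=
  colsub (fun k : 'I_#|J| => enum_val k) X.

Definition supp (R : realType) (p : nat) (b : 'cV[R]_p) : {set 'I_p} :=
  [set j | b j ord0 != 0]%SET.

Definition beta_min (R : realType) (p : nat) (b : 'cV[R]_p) : R :=
  inf [set x : R | exists2 j, j \in supp b & x = `|b j ord0|].

Definition r_n (R : realType) (n p : nat) (X : 'M[R]_(n, p))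
    (S : {set 'I_p}) : R :=
  max_row_sum ((subcols (~: S) X)^T *m subcols S X
               *m invmx ((subcols S X)^T *m subcols S X)).

Definition Lambda_min (R : realType) (n p : nat) (X : 'M[R]_(n, p))
    (s : nat) : R :=
  inf [set x : R | exists (J0 : {set 'I_p}) (g : 'cV[R]_p),
    [/\ (#|J0| <= s)%N, g != 0, subvec (~: J0) g = 0 &
        x = l2norm (X *m g) ^+ 2 / (n%:R * l2norm (subvec J0 g) ^+ 2)]].

(* Jm consists of m coordinates of g outside J0 that are largest in absolute
   value. Ties may leave several such Jm; they all give the same
   l2norm (subvec (J0 :|: Jm) g). *)
Definition top_coords (R : realType) (p : nat) (g : 'cV[R]_p)
    (J0 : {set 'I_p}) (m : nat) (Jm : {set 'I_p}) : Prop :=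
  [/\ #|Jm| = m, Jm \subset ~: J0 &
      forall j k : 'I_p, j \in Jm -> k \notin J0 :|: Jm ->
        `|g k ord0| <= `|g j ord0|].

(* 1 / K(s, m, k0, X) *)
Definition RE_inv (R : realType) (n p s m : nat) (k0 : R)
    (X : 'M[R]_(n, p)) : R :=
  inf [set x : R | exists (J0 Jm : {set 'I_p}) (g : 'cV[R]_p),
    [/\ (#|J0| <= s)%N,
        g != 0,
        l1norm (subvec (~: J0) g) <= k0 * l1norm (subvec J0 g),
        top_coords g J0 m Jm &
        x = l2norm (X *m g)
            / (Num.sqrt n%:R * l2norm (subvec (J0 :|: Jm) g))]].

Definition RE_K (R : realType) (n p s m : nat) (k0 : R)
    (X : 'M[R]_(n, p)) : R :=
  (RE_inv s m k0 X)^-1.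

Definition RE (R : realType) (n p s m : nat) (k0 : R)
    (X : 'M[R]_(n, p)) : Prop :=
  [/\ (1 <= s)%N /\ (2 * s <= p)%N, (s <= m)%N, (s + m <= p)%N, 0 < k0
    & 0 < RE_inv s m k0 X].

Definition mutually_independent (d : measure_display) (T : measurableType d)
    (R : realType) (P : probability T R) (n : nat)
    (eps : 'I_n -> {RV P >-> R}) : Prop :=
  forall (J : {set 'I_n}) (B : 'I_n -> set R),
    (forall i, measurable (B i)) ->
    P (\bigcap_(i in [set` J]) (eps i @^-1` B i))
    = (\prod_(i in J) P (eps i @^-1` B i))%E.

(* eps ~ N(0, sigma^2 I_n); the second parameter of normal_prob is the
   standard deviation. *)
Definition gaussian_noise (d : measure_display) (T : measurableType d)
    (R : realType) (P : probability T R) (n : nat) (sigma : R)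
    (eps : 'I_n -> {RV P >-> R}) : Prop :=
  mutually_independent eps /\
  forall i (B : set R), measurable B ->
    distribution P (eps i) B = normal_prob 0 sigma B.

Definition lasso_obj (R : realType) (n p : nat) (X : 'M[R]_(n, p))
    (y : 'cV[R]_n) (lam : R) (b : 'cV[R]_p) : R :=
  (2 * n%:R)^-1 * l2norm (y - X *m b) ^+ 2 + lam * l1norm b.

(* Minimizers need not be unique when n <= p. *)
Definition is_lasso (R : realType) (n p : nat) (X : 'M[R]_(n, p))
    (y : 'cV[R]_n) (lam : R) (b : 'cV[R]_p) : Prop :=
  forall b' : 'cV[R]_p, lasso_obj X y lam b <= lasso_obj X y lam b'.

Definition lambda_init (R : realType) (n p : nat) (sigma : R) : R :=
  Num.sqrt 24 * sigma * Num.sqrt (ln p%:R / n%:R).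

Definition s_bar (R : realType) (p : nat) (lam : R) (b : 'cV[R]_p) : nat :=
  #|[set j : 'I_p | 4 * lam < `|b j ord0|]%SET|.

Definition adaptive_weight (R : realType) (p : nat) (binit : 'cV[R]_p)
    (j : 'I_p) : \bar R :=
  if binit j ord0 == 0 then +oo%E
  else (Num.max (1 / `|binit j ord0|) 1)%:E.

(* An infinite weight constrains the coordinate to be 0, so that in
   wlasso_obj the value fine +oo = 0 is only ever multiplied by 0. *)
Definition wfeasible (R : realType) (p : nat) (w : 'I_p -> \bar R)
    (b : 'cV[R]_p) : Prop :=
  forall j, w j = +oo%E -> b j ord0 = 0.

Definition wlasso_obj (R : realType) (n p : nat) (X : 'M[R]_(n, p))
    (y : 'cV[R]_n) (lam : R) (w : 'I_p -> \bar R) (b : 'cV[R]_p) : R :=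
  (2 * n%:R)^-1 * l2norm (y - X *m b) ^+ 2
  + lam * \sum_(j < p) fine (w j) * `|b j ord0|.

Definition is_wlasso (R : realType) (n p : nat) (X : 'M[R]_(n, p))
    (y : 'cV[R]_n) (lam : R) (w : 'I_p -> \bar R) (b : 'cV[R]_p) : Prop :=
  wfeasible w b /\
  forall b' : 'cV[R]_p, wfeasible w b' ->
    wlasso_obj X y lam w b <= wlasso_obj X y lam w b'.

(* For a measurable event E this says q <= P E; in general it bounds the
   inner probability of E. It is needed because a selection among several
   minimizers need not be measurable. *)
Definition with_prob_ge (d : measure_display) (T : measurableType d)
    (R : realType) (P : probability T R) (q : R) (E : set T) : Prop :=
  exists A : set T, [/\ measurable A, A `<=` E & (q%:E <= P A)%E].

(* Main.v *)
Require Import Defs.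
From mathcomp Require Import ring lra zify measurable_realfun.
Set Implicit Arguments.
Unset Strict Implicit.
Unset Printing Implicit Defensive.
Local Open Scope classical_set_scope.
Local Open Scope ring_scope.

(** Everything after the choice of a good event is deterministic. Write [tau]
    for [sigma * sqrt (ln p / n)], so that [lambda_init = 2 * sqrt 6 * tau], and
    [u] for [K ^ 2 * lambda_init * sqrt s], the scale of the error of the
    initial estimator.

    The good event consists of the event [TT] of the statement, where the
    correlations of the noise with the columns of [X] are at most
    [sqrt 6 * tau], and of the event where its correlations with the columns of
    [X_{S^c}], projected onto the orthogonal complement of the columns of [X_S],
    are at most [6 * tau]. The second event cannot be deduced from the first
    with a usable constant, because [r_n] may be large. The usual Chernoff
    bound spends the whole budget [2 / p ^ 2] on [TT] alone; Markov's
    inequality applied to [cosh] instead of [exp] gains a factor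
    [1 / (1 + p ^ -12)], and this gain pays for the second event, whose
    threshold is high enough to fail with probability at most [2 / p ^ 17]
    ([gaussian_lin_good_event]). The moment generating function of a linear form
    in the noise comes from the product rule for expectations of independent
    variables ([expectation_prod]).

    On the good event all arguments compare a minimiser [b] of a weighted lasso
    objective with [b - t *: v] for small [t], where [v] is a direction chosen
    for the purpose ([wlasso_first_order]). This applies to every minimiser.
    - For the initial estimator, [v] is its error. With the restricted
      eigenvalue condition this bounds every coordinate of the error by
      [3 / 2 * u], and the l1 norm of the error outside [S] ([lasso_error]).
      So the initial estimator is large on [S] and small elsewhere, the weights
      are small on [S] and at least [2 / (3 * u)] elsewhere, and [s_bar] lies
      between [s] and [(1 + 9 / 8 * K ^ 2) * s].
    - To see that an estimator vanishes outside [S], [v] agrees with the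
      estimator outside [S] and is chosen on [S] so that [X *m v] is orthogonal
      to the columns of [X_S]: the coordinates in [S] then only enter through
      [r_n] and the weights ([resid_direction], [wlasso_off_support]).
    - Once the adaptive estimator vanishes outside [S], taking its error for [v]
      bounds this error by [K ^ 2 * sqrt s * (lambda_init / 2 + mu * wmax)]
      ([wlasso_on_support]), where [mu] is the tuning parameter and [wmax]
      bounds the weights on [S]; below [beta_min] this gives the equality of
      the supports.

    The delicate case of the last step is [wmax = 1]: the bound
    [s_bar <= C * K ^ 2 * s] makes [mu] too large by a factor [K]. Either
    [rtilde >= 1 / 4], and then the bound on [rtilde * sqrt s] forces
    [u <= 1 / 8], which compensates for this factor; or [rtilde < 1 / 4], and
    then the initial estimator itself vanishes outside [S], so that [s_bar = s]
    and the factor does not appear ([adaptive_lasso_support]). *)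

(** * Expectations of products of independent variables *)

Section simple_approximation.
Local Open Scope ereal_scope.
Import HBNNSimple.
Context d (T : measurableType d) (R : realType).
Variables (mu : {measure set T -> \bar R}) (Z : T -> R).
Hypothesis mZ : measurable_fun setT Z.

Lemma integral_mul_nnsfun (g : T -> R) (mg : measurable_fun setT g)
    (g0 : forall x, (0 <= g x)%R) (h : {nnsfun R >-> R}) :
  \int[mu]_x (g x * h (Z x))%:E =
  \sum_(y \in range h) y%:E * \int[mu]_x (g x * \1_(h @^-1` [set y]) (Z x))%:E.
Proof.
have mi y : measurable_fun setT (fun x => \1_(h @^-1` [set y]) (Z x) : R).
  by apply: measurableT_comp => //; exact: measurable_indic.
have yi0 y x : (0 <= y * \1_(h @^-1` [set y]) (Z x))%R.
  by rewrite -lee_fin EFinM nnfun_muleindic_ge0.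
under eq_integral => x _.
  rewrite EFinM fimfunE -fsumEFin// ge0_mule_fsumr; last first.
    by move=> y; rewrite lee_fin yi0.
  over.
rewrite ge0_integral_fsum//.
- apply: eq_fsbigr => y _.
  under eq_integral do rewrite -EFinM mulrCA EFinM.
  have [y0|y0] := leP 0%R y.
    rewrite ge0_integralZl//.
    - by apply/measurable_EFinP; exact: measurable_funM.
    - by move=> x _; rewrite lee_fin mulr_ge0.
  rewrite !integral0_eq ?mule0// => x _; rewrite preimage_nnfun0// indicE in_set0.
    by rewrite mulr0.
  by rewrite mulr0 mule0.
- move=> y; under eq_fun do rewrite -EFinM.
  apply/measurable_EFinP; apply: measurable_funM => //.
  exact: measurable_funM.
- by move=> y x _; rewrite -EFinM lee_fin mulr_ge0.
Qed.

Lemma cvg_integral_nnsfun_approx (g : T -> R) (mg : measurable_fun setT g)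
    (g0 : forall x, (0 <= g x)%R) (f : R -> R) (f0 : forall r, (0 <= f r)%R)
    (mf : measurable_fun setT (EFin \o f)) :
  \int[mu]_x (g x * nnsfun_approx measurableT mf n (Z x))%:E @[n --> \oo] -->
  \int[mu]_x (g x * f (Z x))%:E.
Proof.
pose h := nnsfun_approx measurableT mf.
have hcv x : (h n x)%:E @[n --> \oo] --> (f x)%:E.
  by apply: (cvg_nnsfun_approx measurableT mf) => // y _; rewrite lee_fin.
have hnd x : {homo (fun n => h n x) : m n / (m <= n)%N >-> (m <= n)%R}.
  by move=> m n mn; have /lefP := nd_nnsfun_approx measurableT mf mn.
rewrite (_ : \int[mu]_x (g x * f (Z x))%:E =
    \int[mu]_x limn (fun n => (g x * h n (Z x))%:E)).
  apply: cvg_monotone_convergence => //.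
  - move=> n; apply/measurable_EFinP; apply: measurable_funM => //.
    exact: measurableT_comp.
  - by move=> n x _; rewrite lee_fin mulr_ge0.
  - by move=> x _ m n mn; rewrite lee_fin ler_wpM2l// hnd.
apply: eq_integral => x _; apply/esym/cvg_lim => //.
by rewrite EFinM; under eq_fun do rewrite EFinM; exact: cvgeZl.
Qed.

End simple_approximation.

Section indic_determined.
Local Open Scope ereal_scope.
Import HBNNSimple.
Context d1 (T1 : measurableType d1) d2 (T2 : measurableType d2) (R : realType).
Variables (mu1 : {measure set T1 -> \bar R}) (mu2 : {measure set T2 -> \bar R}).

(** Equality passes from indicators to simple functions by linearity and to the
    limit by monotone convergence. This serves twice: to integrate against a
    density, and to replace one factor of a product of independent variables. *)
Lemma eq_integral_indic (Z1 g1 : T1 -> R) (Z2 g2 : T2 -> R) :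
  measurable_fun setT Z1 -> measurable_fun setT g1 ->
  (forall x, (0 <= g1 x)%R) ->
  measurable_fun setT Z2 -> measurable_fun setT g2 ->
  (forall x, (0 <= g2 x)%R) ->
  (forall B, measurable B -> \int[mu1]_x (g1 x * \1_B (Z1 x))%:E =
                             \int[mu2]_x (g2 x * \1_B (Z2 x))%:E) ->
  forall f : R -> R, measurable_fun setT f -> (forall r, (0 <= f r)%R) ->
  \int[mu1]_x (g1 x * f (Z1 x))%:E = \int[mu2]_x (g2 x * f (Z2 x))%:E.
Proof.
move=> mZ1 mg1 g10 mZ2 mg2 g20 g12 f mf f0.
have mf' : measurable_fun setT (EFin \o f) by exact/measurable_EFinP.
have cvg1 := cvg_integral_nnsfun_approx (mu:=mu1) mZ1 mg1 g10 f0 mf'.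
have cvg2 := cvg_integral_nnsfun_approx (mu:=mu2) mZ2 mg2 g20 f0 mf'.
apply: (cvg_unique _ cvg1) => //; rewrite (_ : (fun n => _) = (fun n =>
  \int[mu2]_x (g2 x * nnsfun_approx measurableT mf' n (Z2 x))%:E))//.
apply/funext => n; rewrite (integral_mul_nnsfun mu1 mZ1)//.
rewrite (integral_mul_nnsfun mu2 mZ2)//.
by apply: eq_fsbigr => y _; rewrite g12.
Qed.
End indic_determined.

Section indep.
Local Open Scope ereal_scope.
Context d (T : measurableType d) (R : realType) (P : probability T R) (n : nat).
Variable eps : 'I_n -> {RV P >-> R}.
Hypothesis Ieps : mutually_independent eps.

(** Induction on the number [k] of factors that are arbitrary functions. For
    [k = 0] all factors are indicators and this is independence; the factor of
    rank [k] passes from indicators to general functions by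
    [eq_integral_indic]. *)
Let expectation_prod_indic_from (k : nat) (F : 'I_n -> R -> R) (E : 'I_n -> R) :
  (forall i, measurable_fun setT (F i)) -> (forall i r, (0 <= F i r)%R) ->
  (forall i, \int[P]_x (F i (eps i x))%:E = (E i)%:E) ->
  (forall i : 'I_n, (k <= i)%N -> exists2 B, measurable B & F i = \1_B) ->
  \int[P]_x (\prod_(i < n) F i (eps i x))%:E = (\prod_(i < n) E i)%:E.
Proof.
elim: k F E => [|k IH] F E mF F0 FE FB.
  have /boolp.choice[B hB] : forall i, exists B : set R, measurable B /\ F i = \1_B.
    by move=> i; have [//|B mB FiB] := FB i; exists B.
  have mB i : measurable (B i) by case: (hB i).
  have FBE i r : F i r = \1_(B i) r by case: (hB i) => _ ->.
  have mI i : measurable (eps i @^-1` B i).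
    by rewrite -[X in measurable X]setTI; exact: measurable_funP.
  have PE i : P (eps i @^-1` B i) = (E i)%:E.
    rewrite -FE; under eq_integral do rewrite FBE.
    rewrite (_ : (fun x => _) = (fun x => (\1_(eps i @^-1` B i) x)%:E))//.
    by rewrite integral_indic// setIT.
  have := Ieps [set: 'I_n]%SET mB.
  under [in RHS]eq_bigr do rewrite PE.
  rewrite prodEFin (eq_bigl xpredT) => [<-|i]; last by rewrite inE.
  rewrite -[in RHS](setIT (\bigcap_(_ in _) _)) -integral_indic//; last first.
    by apply: fin_bigcap_measurable.
  apply: eq_integral => x _; congr EFin.
  have [xB|xB] := pselect
    ((\bigcap_(i in [set` [set: 'I_n]%SET]) (eps i @^-1` B i)) x).
    rewrite [RHS]indicE mem_set//.
    rewrite big1// => i _; rewrite FBE indicE mem_set//.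
    by apply: xB => /=; rewrite inE.
  rewrite [RHS]indicE memNset//.
  have [i iB] : exists i, ~ B i (eps i x).
    by apply/existsNP => h; apply: xB => i _; exact: h.
  by rewrite (bigD1 i)//= FBE indicE memNset// mul0r.
have [nk|kn] := leqP n k.
  apply: IH => // i ki; exfalso.
  by have := ltn_ord i; rewrite ltnNge (leq_trans nk ki).
(* the factor that ceases to be an indicator *)
pose a := Ordinal kn.
under eq_integral do rewrite (bigD1 a)//= mulrC.
rewrite (bigD1 a)//= mulrC EFinM -FE -ge0_integralZl//; last 3 first.
- by apply/measurable_EFinP; exact: measurableT_comp.
- by move=> x _; rewrite lee_fin.
- rewrite lee_fin prodr_ge0// => i _; rewrite -lee_fin -FE.
  by apply: integral_ge0 => x _; rewrite lee_fin.
under [RHS]eq_integral do rewrite -EFinM.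
apply: (@eq_integral_indic _ _ _ _ _ P P (eps a)
  (fun x => \prod_(i < n | i != a) F i (eps i x))%R (eps a)
  (cst (\prod_(i < n | i != a) E i)%R)) => //.
- under eq_fun do rewrite -big_filter.
  by apply: measurable_prod => i _; exact: measurableT_comp.
- by move=> x; rewrite prodr_ge0.
- move=> x; rewrite prodr_ge0// => i _; rewrite -lee_fin -FE.
  by apply: integral_ge0 => y _; rewrite lee_fin.
- move=> B mB.
  under [RHS]eq_integral do rewrite /cst EFinM.
  rewrite ge0_integralZl//; last 2 first.
  + apply/measurable_EFinP.
    by apply: (measurableT_comp (measurable_indic mB)).
  + rewrite lee_fin prodr_ge0// => i _; rewrite -lee_fin -FE.
    by apply: integral_ge0 => y _; rewrite lee_fin.
  pose F' i := if i == a then \1_B else F i.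
  pose E' i := if i == a then fine (P (eps a @^-1` B)) else E i.
  have mI : measurable (eps a @^-1` B).
    by rewrite -[X in measurable X]setTI; exact: measurable_funP.
  have IB : \int[P]_x (\1_B (eps a x))%:E = P (eps a @^-1` B).
    rewrite (_ : (fun x => _) = (fun x => (\1_(eps a @^-1` B) x)%:E))//.
    by rewrite integral_indic// setIT.
  have E'a : (E' a)%:E = \int[P]_x (\1_B (eps a x))%:E.
    by rewrite IB /E' eqxx fineK// fin_num_measure.
  have := IH F' E'; rewrite (bigD1 a)//= EFinM E'a muleC => H.
  transitivity (\int[P]_x (\prod_(i < n) F' i (eps i x))%:E).
    apply: eq_integral => x _; rewrite [in RHS](bigD1 a)//= [in F' a]/F' eqxx mulrC.
    by congr (_ * _)%:E; apply: eq_bigr => i ia; rewrite /F' (negbTE ia).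
  rewrite H.
  + by congr (_%:E * _); apply: eq_bigr => i ia; rewrite /E' (negbTE ia).
  + by move=> i; rewrite /F'; case: eqP => // _; exact: measurable_indic.
  + by move=> i r; rewrite /F'; case: eqP.
  + move=> i; rewrite /F' /E'; case: eqP => [->|_]; last exact: FE.
    by rewrite fineK ?fin_num_measure.
  + move=> i ki; rewrite /F'; case: eqP => [_|/eqP ia]; first by exists B.
    by apply: FB; rewrite ltn_neqAle ki andbT eq_sym.
Qed.

Lemma expectation_prod (F : 'I_n -> R -> R) (E : 'I_n -> R) :
  (forall i, measurable_fun setT (F i)) -> (forall i r, (0 <= F i r)%R) ->
  (forall i, \int[P]_x (F i (eps i x))%:E = (E i)%:E) ->
  \int[P]_x (\prod_(i < n) F i (eps i x))%:E = (\prod_(i < n) E i)%:E.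
Proof.
move=> mF F0 FE; apply: (@expectation_prod_indic_from n) => // i ni.
by have := ltn_ord i; rewrite ltnNge ni.
Qed.
End indep.

(** * Tails of linear forms in Gaussian noise *)

Section gaussian.
Context d (T : measurableType d) (R : realType) (P : probability T R) (n : nat).
Variables (sigma : R) (eps : 'I_n -> {RV P >-> R}).
Hypotheses (sigma0 : 0 < sigma) (Geps : gaussian_noise sigma eps).

(** Completing the square: an exponential tilt only moves the mean. *)
Lemma normal_pdf_expR (c x : R) : normal_pdf 0 sigma x * expR (c * x) =
  expR (c ^+ 2 * sigma ^+ 2 / 2) * normal_pdf (c * sigma ^+ 2) sigma x.
Proof.
rewrite !normal_pdfE ?gt_eqF//= -[LHS]mulrA [RHS]mulrCA; congr (_ * _).
rewrite /normal_fun -!expRD; congr expR.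
by field; rewrite gt_eqF.
Qed.

Lemma gaussian_mgf (i : 'I_n) (c : R) :
  (\int[P]_x (expR (c * eps i x))%:E)%E = (expR (c ^+ 2 * sigma ^+ 2 / 2))%:E.
Proof.
transitivity (\int[P]_x ((cst 1 : T -> R) x * expR (c * eps i x))%:E)%E.
  by under [RHS]eq_integral do rewrite mul1r.
rewrite (@eq_integral_indic _ _ _ _ _ P lebesgue_measure (eps i) (cst 1)
  id (normal_pdf 0 sigma) _ _ _ _ _ _ _ (fun r => expR (c * r)))//.
- under eq_integral do rewrite normal_pdf_expR EFinM.
  rewrite ge0_integralZl//.
  + by rewrite integral_normal_pdf mule1.
  + by apply/measurable_EFinP; exact: measurable_normal_pdf.
  + by move=> x _; rewrite lee_fin normal_pdf_ge0.
- exact: measurable_normal_pdf.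
- by move=> x; exact: normal_pdf_ge0.
- move=> B mB; under eq_integral do rewrite mul1r.
  transitivity (normal_prob 0 sigma B); last first.
    rewrite /normal_prob [LHS]integral_mkcond; apply: eq_integral => x _.
    by rewrite epatch_indic EFinM.
  have := Geps.2 i B mB => <-; rewrite (_ : (fun x => _) =
    (fun x => (\1_(eps i @^-1` B) x)%:E))//.
  rewrite integral_indic// ?setIT//.
  by rewrite -[X in measurable X]setTI; exact: measurable_funP.
- by apply: measurableT_comp => //; exact: mulrl_measurable.
Qed.

Lemma gaussian_lin_mgf (c : 'I_n -> R) :
  (\int[P]_x (expR (\sum_(i < n) c i * eps i x))%:E)%E =
  (expR (sigma ^+ 2 * (\sum_(i < n) c i ^+ 2) / 2))%:E.
Proof.
under eq_integral do rewrite expR_sum.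
rewrite (expectation_prod Geps.1 (F := fun i r => expR (c i * r))
  (E := fun i => expR (c i ^+ 2 * sigma ^+ 2 / 2)))//.
- rewrite -expR_sum; congr (expR _)%:E.
  rewrite mulr_sumr mulr_suml; apply: eq_bigr => i _; ring.
- by move=> i; apply: measurableT_comp => //; exact: mulrl_measurable.
- by move=> i; exact: gaussian_mgf.
Qed.

Lemma expR_addN_nondecreasing (u v : R) : 0 <= u -> u <= v ->
  expR u + expR (- u) <= expR v + expR (- v).
Proof.
move=> u0 uv; rewrite -subr_ge0 !expRN.
rewrite (_ : _ - _ = (expR v - expR u) * (1 - (expR u)^-1 * (expR v)^-1)).
  apply: mulr_ge0; first by rewrite subr_ge0 ler_expR.
  rewrite -!expRN -expRD subr_ge0 -[leRHS]expR0 ler_expR; lra.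
by field; rewrite ?gt_eqF ?expR_gt0.
Qed.

(** Markov's inequality for [2 * cosh (s * W)], where [W] is the linear form and
    [s = a / (sigma * sqrt V)] is the optimal Chernoff parameter. Using [cosh]
    treats both tails at once; the denominator [1 + exp (- 2 a ^ 2)] is its gain
    over the sum of two Chernoff bounds. *)
Lemma gaussian_lin_tail (c : 'I_n -> R) (V a : R) : 0 < V -> 0 <= a ->
  \sum_(i < n) c i ^+ 2 <= V ->
  (P [set t | (sigma * Num.sqrt V * a < `|\sum_(i < n) c i * eps i t|)%R] <=
   (2 * expR (- (a ^+ 2 / 2)) / (1 + expR (- (2 * a ^+ 2))))%:E)%E.
Proof.
move=> V0 a0 cV; set W := fun t => \sum_(i < n) c i * eps i t.
have mW : measurable_fun setT W.
  by apply: measurable_sum => i; apply: measurable_funM.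
set r := sigma * Num.sqrt V; have r0 : 0 < r by rewrite mulr_gt0 ?sqrtr_gt0.
set A := [set t | _].
have mA : measurable A.
  rewrite (_ : A = setT `&` (fun t => `|W t|) @^-1` `]r * a, +oo[%classic).
    by apply: (measurableT_comp _ mW) => //; exact: measurable_itv.
  by rewrite setTI; apply/seteqP; split => t; rewrite /A /= in_itv/= andbT.
pose s := a / r; have s0 : 0 <= s by rewrite divr_ge0// ltW.
pose kappa := expR (a ^+ 2) + expR (- a ^+ 2).
have k0 : 0 < kappa by rewrite addr_gt0 ?expR_gt0.
(* [u] is the sign 1 or -1 *)
have sW (u : R) : u ^+ 2 = 1 -> forall t,
    expR (u * s * W t) = expR (\sum_(i < n) (u * s * c i) * eps i t).
  by move=> _ t; rewrite mulr_sumr; congr expR; apply: eq_bigr => i _; rewrite mulrA.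
have IW (u : R) : u ^+ 2 = 1 ->
    (\int[P]_t (expR (u * s * W t))%:E <= (expR (a ^+ 2 / 2))%:E)%E.
  move=> u1; under eq_integral do rewrite (sW u u1).
  rewrite gaussian_lin_mgf lee_fin ler_expR ler_pM2r ?invr_gt0//.
  under eq_bigr do rewrite exprMn exprMn u1 mul1r.
  rewrite -mulr_sumr (le_trans (y := sigma ^+ 2 * (s ^+ 2 * V)))//.
    by rewrite !ler_wpM2l// sqr_ge0.
  rewrite /s exprMn exprVn /r exprMn (sqr_sqrtr (ltW V0)).
  by rewrite (_ : sigma ^+ 2 * _ = a ^+ 2)//; field; rewrite !gt_eqF.
have mE (u : R) : measurable_fun setT (fun t => expR (u * s * W t)).
  by apply: measurableT_comp => //; exact: measurable_funM.
have Mk : (kappa%:E * P A <= (2 * expR (a ^+ 2 / 2))%:E)%E.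
  rewrite -[A]setIT -integral_indic// -ge0_integralZl//; last 2 first.
  - by apply/measurable_EFinP; exact: measurable_indic.
  - by rewrite lee_fin ltW.
  apply: (@le_trans _ _
    (\int[P]_t ((expR (1 * s * W t))%:E + (expR (-1 * s * W t))%:E))%E).
    apply: ge0_le_integral => //.
    - by move=> t _; rewrite -EFinM lee_fin mulr_ge0// ltW.
    - apply: measurable_funeM; apply/measurable_EFinP.
      exact: measurable_indic.
    - by apply/measurable_EFinP; apply: measurable_funD.
    - move=> t _; rewrite -EFinM -EFinD lee_fin indicE.
      have [|] := boolP (t \in A); rewrite ?inE ?mulr0 ?addr_ge0 ?expR_ge0//.
      rewrite mulr1 /A /= => tA.
      have aW : a ^+ 2 <= s * `|W t|.
        rewrite expr2 /s -mulrA ler_wpM2l// ler_pdivlMl//; exact: ltW.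
      apply: (le_trans (expR_addN_nondecreasing (sqr_ge0 a) aW)).
      rewrite mul1r mulN1r mulNr; have [W0|W0] := ger0P (W t) => //.
      by rewrite mulrN opprK addrC.
  rewrite ge0_integralD//.
  + by rewrite mulr_natl mulr2n EFinD; apply: leeD; apply: IW; rewrite ?sqrrN expr1n.
  + exact/measurable_EFinP.
  + exact/measurable_EFinP.
have -> : 2 * expR (- (a ^+ 2 / 2)) / (1 + expR (- (2 * a ^+ 2))) =
    kappa^-1 * (2 * expR (a ^+ 2 / 2)).
  rewrite /kappa !expRN (_ : a ^+ 2 = 2 * (a ^+ 2 / 2)); last by field.
  set b := a ^+ 2 / 2.
  rewrite (_ : 2 * (2 * b) = 4 * b) ?expRM_natl; last ring.
  rewrite (_ : 2 * b / 2 = b); last by field.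
  have b0 := expR_gt0 b; field.
  by rewrite !gt_eqF// ?addr_gt0 ?exprn_gt0.
by rewrite EFinM lee_pdivlMl.
Qed.
End gaussian.

Lemma measure_bigsetU_le d (T : measurableType d) (R : realType)
    (P : {measure set T -> \bar R}) (q : nat) (B : 'I_q -> set T) (x : R) :
  (forall i, measurable (B i)) -> (forall i, (P (B i) <= x%:E)%E) ->
  measurable (\big[setU/set0]_(i < q) B i) /\
  (P (\big[setU/set0]_(i < q) B i) <= (q%:R * x)%:E)%E.
Proof.
move=> mB PB; split; first exact: bigsetU_measurable.
elim: q B mB PB => [|q IH] B mB PB; first by rewrite big_ord0 measure0 mul0r.
rewrite big_ord_recr/= -natr1 mulrDl mul1r EFinD.
apply: le_trans (leeD (IH _ (fun i => mB _) (fun i => PB _)) (PB ord_max)).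
by apply: measureU2 => //; apply: bigsetU_measurable.
Qed.

Section good_event.
Context d (T : measurableType d) (R : realType) (P : probability T R) (n : nat).
Variables (sigma : R) (eps : 'I_n -> {RV P >-> R}).
Hypotheses (sigma0 : 0 < sigma) (Geps : gaussian_noise sigma eps).

(** Two families of linear forms are controlled at once. At the level
    [sqrt (6 * ln p)] each of the [p] forms fails with probability at most
    [2 * p ^ -3 / (1 + p ^ -12)], which leaves [2 * p ^ -14 / (1 + p ^ -12)] of
    the budget [2 * p ^ -2]; at the level [sqrt (36 * ln p)] a form fails with
    probability at most [2 * p ^ -18], so [p] further forms fit in. *)
Lemma gaussian_lin_good_event (p q : nat) (c1 : 'I_p -> 'I_n -> R)
    (c2 : 'I_q -> 'I_n -> R) (V : R) :
  (1 < p)%N -> (q <= p)%N -> 0 < V ->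
  (forall j, \sum_(i < n) c1 j i ^+ 2 <= V) ->
  (forall k, \sum_(i < n) c2 k i ^+ 2 <= V) ->
  exists A : set T, [/\ measurable A,
   ((1 - 2 / p%:R ^+ 2)%:E <= P A)%E &
   forall t, A t ->
    (forall j, `|\sum_(i < n) c1 j i * eps i t| <=
               sigma * Num.sqrt V * Num.sqrt (6 * ln p%:R)) /\
    (forall k, `|\sum_(i < n) c2 k i * eps i t| <=
               sigma * Num.sqrt V * Num.sqrt (36 * ln p%:R))].
Proof.
move=> p1 qp V0 c1V c2V.
have p0 : 0 < p%:R :> R by rewrite ltr0n (ltn_trans _ p1).
have lnp : 0 <= ln (p%:R : R) by rewrite ln_ge0// ler1n (ltn_trans _ p1).
pose bad (c : 'I_n -> R) (a : R) :=
  [set t | (sigma * Num.sqrt V * Num.sqrt (a * ln p%:R)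
            < `|\sum_(i < n) c i * eps i t|)%R].
have mbad c a : measurable (bad c a).
  have mW : measurable_fun setT (fun t => \sum_(i < n) c i * eps i t).
    by apply: measurable_sum => i; apply: measurable_funM.
  rewrite (_ : bad c a = setT `&` (fun t => `|\sum_(i < n) c i * eps i t|) @^-1`
      `]sigma * Num.sqrt V * Num.sqrt (a * ln p%:R), +oo[%classic).
    by apply: (measurableT_comp _ mW) => //; exact: measurable_itv.
  by rewrite setTI; apply/seteqP; split => t; rewrite /bad /= in_itv/= andbT.
pose y : R := p%:R^-1.
have y0 : 0 < y by rewrite invr_gt0.
have y2 : y <= 2^-1 by rewrite lef_pV2 ?posrE// ler_nat.
have Pbad c k : \sum_(i < n) c i ^+ 2 <= V ->
    (P (bad c (2 * k%:R)%R) <= (2 * y ^+ k / (1 + y ^+ (4 * k)))%:E)%E.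
  move=> cV; apply: le_trans (gaussian_lin_tail sigma0 Geps V0 (sqrtr_ge0 _) cV) _.
  rewrite sqr_sqrtr; last by rewrite !mulr_ge0.
  rewrite (_ : 2 * k%:R * ln p%:R / 2 = k%:R * ln p%:R); last by field.
  rewrite (_ : 2 * (2 * k%:R * ln p%:R) = (4 * k)%:R * ln p%:R); last first.
    by rewrite natrM; ring.
  by rewrite !expRN !expRM_natl lnK ?posrE// /y !exprVn.
have [m1 P1] := @measure_bigsetU_le _ _ _ P p (fun j => bad (c1 j) (2 * 3)) _
  (fun j => mbad (c1 j) _) (fun j => Pbad (c1 j) 3%N (c1V j)).
have [m2 P2] := @measure_bigsetU_le _ _ _ P q (fun j => bad (c2 j) (2 * 18)) _
  (fun j => mbad (c2 j) _) (fun j => Pbad (c2 j) 18%N (c2V j)).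
set B1 := \big[setU/set0]_(j < p) _ in m1 P1.
set B2 := \big[setU/set0]_(j < q) _ in m2 P2.
exists (~` (B1 `|` B2)); split.
- exact/measurableC/measurableU.
- rewrite probability_setC; last exact: measurableU.
  rewrite EFinB leeB// (le_trans (measureU2 _ _ _))//.
  apply: (le_trans (leeD P1 P2)); rewrite -EFinD lee_fin.
  have -> : 2 / p%:R ^+ 2 = 2 * y ^+ 2 by rewrite /y exprVn.
  have qy : q%:R <= y^-1 by rewrite invrK ler_nat.
  have z0 k : 0 < y ^+ k by rewrite exprn_gt0.
  have z1 k : y ^+ k <= 1 by apply: exprn_ile1; [exact: ltW | lra].
  have q18 : q%:R * (2 * y ^+ 18 / (1 + y ^+ (4 * 18))) <= y^-1 * (2 * y ^+ 18).
    apply: ler_pM => //; first by rewrite divr_ge0 ?mulr_ge0// ltW// addr_gt0.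
    by rewrite ler_pdivrMr ?addr_gt0// ler_peMr ?mulr_ge0 ?ltW// ltrDl.
  apply: (le_trans (lerD (lexx _) q18)).
  rewrite -[p%:R]invrK -/y -subr_ge0.
  rewrite (_ : _ - _ = 2 * y ^+ 14 / (1 + y ^+ 12) * (1 - y ^+ 3 * (1 + y ^+ 12))).
    rewrite mulr_ge0//; first by rewrite divr_ge0 ?mulr_ge0 ?ltW// addr_gt0.
    have : y ^+ 3 * (1 + y ^+ 12) <= (2^-1) ^+ 3 * (1 + 1).
      apply: ler_pM; [exact: ltW | by apply: addr_ge0; rewrite ?ler01 ?ltW | | ].
        by apply: lerXn2r => //; rewrite nnegrE ltW.
      by rewrite lerD2l.
    lra.
  rewrite (_ : 4 * 3 = 12)%N//; field.
  by rewrite !gt_eqF// addr_gt0.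
- move=> t /not_orP[n1 n2]; split => j; rewrite leNgt; apply/negP => h.
  + apply: n1; rewrite /B1 -bigcup_seq; exists j => /=; first by rewrite mem_index_enum.
    by rewrite /bad /= -natrM.
  + apply: n2; rewrite /B2 -bigcup_seq; exists j => /=; first by rewrite mem_index_enum.
    by rewrite /bad /= -natrM.
Qed.
End good_event.

(** * Vectors and their restrictions to a set of coordinates *)

Definition dot (R : realType) (k : nat) (u v : 'cV[R]_k) : R := (u^T *m v) ord0 ord0.

Section vectors.
Context (R : realType).

Lemma dotE k (u v : 'cV[R]_k) : dot u v = \sum_(i < k) u i ord0 * v i ord0.
Proof. by rewrite /dot mxE; apply: eq_bigr => i _; rewrite mxE. Qed.

Lemma dotDl k (u v w : 'cV[R]_k) : dot (u + v) w = dot u w + dot v w.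
Proof. by rewrite /dot linearD mulmxDl mxE. Qed.

Lemma dotDr k (u v w : 'cV[R]_k) : dot w (u + v) = dot w u + dot w v.
Proof. by rewrite /dot mulmxDr mxE. Qed.

Lemma dotBl k (u v w : 'cV[R]_k) : dot (u - v) w = dot u w - dot v w.
Proof. by rewrite /dot linearB mulmxBl !mxE. Qed.

Lemma dotZl k a (u w : 'cV[R]_k) : dot (a *: u) w = a * dot u w.
Proof. by rewrite /dot linearZ/= -scalemxAl mxE. Qed.

Lemma dotC k (u v : 'cV[R]_k) : dot u v = dot v u.
Proof. by rewrite !dotE; apply: eq_bigr => i _; rewrite mulrC. Qed.

Lemma dotZr k a (u w : 'cV[R]_k) : dot w (a *: u) = a * dot w u.
Proof. by rewrite dotC dotZl dotC. Qed.

Lemma dot_mulmx k m (A : 'M[R]_(k, m)) u v : dot u (A *m v) = dot (A^T *m u) v.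
Proof. by rewrite /dot trmx_mul trmxK mulmxA. Qed.

Lemma l2norm_ge0 k (v : 'cV[R]_k) : 0 <= l2norm v.
Proof. exact: sqrtr_ge0. Qed.

Lemma l2norm_sqr k (v : 'cV[R]_k) : l2norm v ^+ 2 = dot v v.
Proof.
rewrite /l2norm sqr_sqrtr ?sumr_ge0// => [|i _]; last exact: sqr_ge0.
by rewrite dotE; apply: eq_bigr => i _; rewrite expr2.
Qed.

Lemma dotvv_ge0 k (v : 'cV[R]_k) : 0 <= dot v v.
Proof. by rewrite -l2norm_sqr sqr_ge0. Qed.

Lemma dot_le_sup_l1 k (a u : 'cV[R]_k) c : (forall j, `|a j ord0| <= c) ->
  dot a u <= c * \sum_j `|u j ord0|.
Proof.
move=> ac; rewrite dotE mulr_sumr; apply: ler_sum => j _.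
by rewrite (le_trans (ler_norm _))// normrM ler_wpM2r.
Qed.

(** The Cauchy-Schwarz inequality against the indicator of [J], proved as the
    non-negativity of a variance. *)
Lemma l1_sqr_le (I : finType) (J : {set I}) (a : I -> R) :
  (\sum_(j in J) `|a j|) ^+ 2 <= #|J|%:R * \sum_(j in J) a j ^+ 2.
Proof.
have [J0|J0] := posnP #|J|.
  by rewrite J0 mul0r big1 ?expr0n// => j; rewrite (cards0_eq J0) inE.
have c0 : 0 < #|J|%:R :> R by rewrite ltr0n.
set A := \sum_(j in J) `|a j|; set B := \sum_(j in J) _.
have : 0 <= \sum_(j in J) (`|a j| - A / #|J|%:R) ^+ 2.
  by apply: sumr_ge0 => j _; exact: sqr_ge0.
under eq_bigr do rewrite sqrrB real_normK ?num_real//.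
rewrite big_split/= sumrB -/B sumrMnl -mulr_suml -/A sumr_const => h.
rewrite mulrC -ler_pdivrMr// -[_ <= _]subr_ge0.
rewrite (_ : B - _ = B - A * (A / #|J|%:R) *+ 2 + (A / #|J|%:R) ^+ 2 *+ #|J|)//.
by rewrite -[RHS]addrA -[_ *+ #|J|]mulr_natr; field; rewrite gt_eqF.
Qed.

Variables (p : nat).
Implicit Types (J S : {set 'I_p}) (g : 'cV[R]_p).

Lemma sum_subvec (F : R -> R) J g :
  \sum_(k < #|J|) F (subvec J g k ord0) = \sum_(j in J) F (g j ord0).
Proof. by rewrite [RHS]big_enum_val; apply: eq_bigr => k _; rewrite mxE. Qed.

Lemma l1norm_subvec J g : l1norm (subvec J g) = \sum_(j in J) `|g j ord0|.
Proof. exact: (sum_subvec (fun x => `|x|)). Qed.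

Lemma l2norm_subvec_sqr J g : l2norm (subvec J g) ^+ 2 = \sum_(j in J) g j ord0 ^+ 2.
Proof.
rewrite l2norm_sqr dotE -(sum_subvec (fun x => x ^+ 2)).
by apply: eq_bigr => k _; rewrite expr2.
Qed.

Lemma sum_setC (V : nmodType) S (F : 'I_p -> V) :
  \sum_j F j = \sum_(j in S) F j + \sum_(j in ~: S) F j.
Proof.
rewrite (bigID (mem S))/=; congr (_ + _).
by apply: eq_bigl => j; rewrite inE.
Qed.

Lemma mulmx_split n (X : 'M[R]_(n, p)) S g :
  X *m g = subcols S X *m subvec S g + subcols (~: S) X *m subvec (~: S) g.
Proof.
apply/colP => i; rewrite !mxE (sum_setC S).
rewrite [X in X + _ = _]big_enum_val [X in _ + X = _]big_enum_val.
by congr (_ + _); apply: eq_bigr => k _; rewrite !mxE.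
Qed.

Lemma extend_subvec S (a : 'cV[R]_#|S|) g :
  exists v : 'cV[R]_p, subvec S v = a /\ (forall j, j \notin S -> v j ord0 = g j ord0).
Proof.
exists (\col_j if [pick k | enum_val k == j] is Some k then a k ord0 else g j ord0).
split.
  apply/colP => k; rewrite !mxE; case: pickP => [l /eqP /enum_val_inj -> //|].
  by move=> /(_ k); rewrite eqxx.
move=> j jS; rewrite mxE; case: pickP => // k /eqP kj.
by move: jS; rewrite -kj enum_valP.
Qed.

Lemma eq_subvec S g g' : (forall j, j \in S -> g j ord0 = g' j ord0) ->
  subvec S g = subvec S g'.
Proof. by move=> h; apply/colP => k; rewrite !mxE h// enum_valP. Qed.

End vectors.

(** * Consequences of the restricted eigenvalue condition *)

Section restricted_eigenvalue.
Context (R : realType) (n p : nat) (X : 'M[R]_(n, p)).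
Implicit Types (J S : {set 'I_p}) (g : 'cV[R]_p).

Lemma top_coords_exist g J0 m : (m <= #|~: J0|)%N -> exists Jm, top_coords g J0 m Jm.
Proof.
elim: m => [_|m IH mJ].
  exists finset.set0; split; first exact: cards0.
    exact: finset.sub0set.
  by move=> j k; rewrite inE.
have [Jm [cJm sJm tJm]] := IH (ltnW mJ).
have [i0 i0P] : exists i, i \in ~: (J0 :|: Jm).
  apply/finset.set0Pn; rewrite -card_gt0 finset.setCU -finset.setDE.
  rewrite cardsD (finset.setIidPr sJm) cJm.
  by rewrite subn_gt0.
pose i := [arg max_(i > i0 in ~: (J0 :|: Jm)) `|g i ord0|]%O.
have [iP imax] : i \in ~: (J0 :|: Jm) /\
    forall k, k \in ~: (J0 :|: Jm) -> `|g k ord0| <= `|g i ord0|.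
  by rewrite /i; case: (arg_maxP (fun i => `|g i ord0|) i0P) => j ? ?; split.
move: (iP); rewrite !inE negb_or => /andP[iJ0 iJm].
exists (i |: Jm); split.
- by rewrite cardsU1 iJm cJm.
- by rewrite finset.subUset finset.sub1set inE iJ0.
- move=> j k; rewrite !inE !negb_or => jP /and3P[kJ0 ki kJm].
  have kP : k \notin J0 :|: Jm by rewrite inE negb_or kJ0.
  case/orP: jP => [/eqP ->|jJm]; last exact: tJm.
  by apply: imax; rewrite inE.
Qed.

Lemma RE_inv_le s m (k0 : R) J0 Jm g : (0 < n)%N ->
  (#|J0| <= s)%N -> g != 0 ->
  l1norm (subvec (~: J0) g) <= k0 * l1norm (subvec J0 g) ->
  top_coords g J0 m Jm ->
  RE_inv s m k0 X * l2norm (subvec (J0 :|: Jm) g) <=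
  Num.sqrt (dot (X *m g) (X *m g) / n%:R).
Proof.
move=> n0 J0s gN0 cone top.
have sn0 : 0 < Num.sqrt n%:R :> R by rewrite sqrtr_gt0 ltr0n.
have -> : Num.sqrt (dot (X *m g) (X *m g) / n%:R) = l2norm (X *m g) / Num.sqrt n%:R.
  rewrite sqrtrM ?dotvv_ge0// -l2norm_sqr sqrtr_sqr ger0_norm ?l2norm_ge0//.
  by rewrite sqrtrV.
have [N0|N0] := eqVneq (l2norm (subvec (J0 :|: Jm) g)) 0.
  by rewrite N0 mulr0 divr_ge0 ?l2norm_ge0// ltW.
have Npos : 0 < l2norm (subvec (J0 :|: Jm) g) by rewrite lt_def N0 l2norm_ge0.
rewrite -ler_pdivlMr// -mulrA -invfM.
apply: ge_inf; last by exists J0, Jm, g.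
exists 0 => _ [J1 [J2 [g' [_ _ _ _ ->]]]].
by rewrite divr_ge0 ?l2norm_ge0// mulr_ge0 ?l2norm_ge0// ltW.
Qed.

(** The form in which the condition is used: [N] is the l2 norm of [g] on [S]
    and its [m] largest coordinates elsewhere. It also bounds every coordinate
    of [g], since those left out are dominated by one that is kept. *)
Lemma RE_cone S s m (k0 : R) g : (0 < n)%N -> #|S| = s -> RE s m k0 X ->
  \sum_(j in ~: S) `|g j ord0| <= k0 * \sum_(j in S) `|g j ord0| ->
  exists N : R, [/\ 0 <= N,
    N ^+ 2 <= RE_K s m k0 X ^+ 2 * (dot (X *m g) (X *m g) / n%:R),
    \sum_(j in S) g j ord0 ^+ 2 <= N ^+ 2 &
    forall j, `|g j ord0| <= N].
Proof.
move=> n0 Ss [[s1 _] sm smp k00 K0] cone.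
have [->|gN0] := eqVneq g 0.
  exists 0; split => //.
  - by rewrite expr0n mulr_ge0 ?sqr_ge0// divr_ge0 ?dotvv_ge0.
  - by rewrite big1 ?expr0n// => j _; rewrite mxE expr0n.
  - by move=> j; rewrite mxE normr0.
have [Jm top] : exists Jm, top_coords g S m Jm.
  apply: top_coords_exist; rewrite cardsCs finset.setCK Ss card_ord.
  by rewrite leq_subRL ?(leq_trans _ smp) ?leq_addr.
exists (l2norm (subvec (S :|: Jm) g)); split.
- exact: l2norm_ge0.
- have Sles : (#|S| <= s)%N by rewrite Ss.
  have cone' : l1norm (subvec (~: S) g) <= k0 * l1norm (subvec S g).
    by rewrite !l1norm_subvec.
  have h := RE_inv_le n0 Sles gN0 cone' top.
  rewrite /RE_K -[dot _ _ / _]sqr_sqrtr ?divr_ge0 ?dotvv_ge0// -exprMn.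
  rewrite lerXn2r ?nnegrE ?l2norm_ge0 ?mulr_ge0 ?sqrtr_ge0 ?invr_ge0 ?(ltW K0)//.
  by rewrite ler_pdivlMl.
- rewrite l2norm_subvec_sqr [leRHS](big_setID S)/=.
  rewrite finset.setUK lerDl; apply: sumr_ge0 => j _; exact: sqr_ge0.
- have bnd j : j \in S :|: Jm -> `|g j ord0| <= l2norm (subvec (S :|: Jm) g).
    move=> jJ; rewrite -[leLHS]ger0_norm// -sqrtr_sqr /l2norm ler_wsqrtr//.
    have := l2norm_subvec_sqr (S :|: Jm) g.
    rewrite l2norm_sqr dotE; under eq_bigr do rewrite -expr2.
    move=> ->; rewrite real_normK ?num_real// (bigD1 j)//= lerDl.
    by apply: sumr_ge0 => k _; exact: sqr_ge0.
  move=> j; have [jJ|jJ] := boolP (j \in S :|: Jm); first exact: bnd.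
  case: top => cJm sJm top.
  have [i iJm] : exists i, i \in Jm.
    by apply/finset.set0Pn; rewrite -card_gt0 cJm (leq_trans s1).
  by apply: le_trans (top i j iJm jJ) (bnd _ _); rewrite inE iJm orbT.
Qed.

(** Tested on a basis vector: a column of [X] has l2 norm at most [sqrt n]. *)
Lemma RE_K_ge1 s m (k0 : R) : (0 < n)%N -> RE s m k0 X ->
  (forall j : 'I_p, l2norm (col j X) <= Num.sqrt n%:R) -> 1 <= RE_K s m k0 X.
Proof.
move=> n0 [[s1 _] sm smp k00 K0] colX.
have p0 : (0 < p)%N by rewrite (leq_trans _ smp)// ltn_addr.
pose i := Ordinal p0; pose g : 'cV[R]_p := delta_mx i ord0.
have gE j : g j ord0 = (j == i)%:R by rewrite mxE andbT.
have gN0 : g != 0.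
  by apply/eqP => /colP/(_ i); rewrite gE mxE eqxx => /eqP; rewrite oner_eq0.
have [Jm top] : exists Jm, top_coords g [set i]%SET m Jm.
  apply: top_coords_exist; rewrite cardsCs finset.setCK cards1 card_ord.
  by rewrite leq_subRL// (leq_trans _ smp)// leq_add2r.
have cone : l1norm (subvec (~: [set i]%SET) g) <= k0 * l1norm (subvec [set i]%SET g).
  rewrite !l1norm_subvec big1 => [|j]; last first.
    by rewrite !inE gE => /negbTE ->; rewrite normr0.
  by rewrite mulr_ge0 ?sumr_ge0// ltW.
have i1 : (#|[set i]%SET| <= s)%N by rewrite cards1.
have := RE_inv_le n0 i1 gN0 cone top.
have -> : l2norm (subvec ([set i]%SET :|: Jm) g) = 1.
  apply/eqP; rewrite -(@eqrXn2 _ 2)// ?l2norm_ge0// l2norm_subvec_sqr expr1n.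
  rewrite (bigD1 i) ?inE ?eqxx//= gE eqxx expr1n big1 ?addr0// => j /andP[_ ji].
  by rewrite gE (negbTE ji) expr0n.
rewrite mulr1 => /le_trans h; rewrite /RE_K invf_ge1//; apply: h.
rewrite -[leRHS]sqrtr1 ler_wsqrtr// ler_pdivrMr ?ltr0n// mul1r -colE -l2norm_sqr.
rewrite -[leRHS]sqr_sqrtr// lerXn2r// ?nnegrE ?l2norm_ge0 ?sqrtr_ge0//.
Qed.

End restricted_eigenvalue.

(** * Projecting out the columns of the support *)

Section residual_design.
Context (R : realType) (n p : nat) (X : 'M[R]_(n, p)) (S : {set 'I_p}).

(** The matrix whose norm is [r_n X S]. *)
Definition irrep_mx : 'M[R]_(#|~: S|, #|S|) :=
  (subcols (~: S) X)^T *m subcols S X *m invmx ((subcols S X)^T *m subcols S X).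

(** The projection of the columns outside [S] onto the orthogonal complement of
    the columns in [S]. *)
Definition resid_mx : 'M[R]_(n, #|~: S|) :=
  subcols (~: S) X - subcols S X *m irrep_mx^T.

Lemma gram_unit s m (k0 : R) : (0 < n)%N -> #|S| = s -> RE s m k0 X ->
  (subcols S X)^T *m subcols S X \in unitmx.
Proof.
move=> n0 Ss hRE; rewrite -row_free_unit -kermx_eq0; apply/rowV0P => u.
move=> /sub_kermxP uM.
have [g [gS gSc]] := extend_subvec u^T (0 : 'cV[R]_p).
have gc0 : subvec (~: S) g = 0.
  apply/colP => k; rewrite !mxE gSc ?mxE//.
  by have := enum_valP k; rewrite inE.
have Xg : dot (X *m g) (X *m g) = 0.
  rewrite (mulmx_split X S) gc0 mulmx0 addr0 gS dot_mulmx mulmxA.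
  rewrite (_ : _ *m u^T = 0) ?/dot ?trmx0 ?mul0mx ?mxE//.
  by apply: trmx_inj; rewrite trmx0 !trmx_mul !trmxK.
have [] := @RE_cone _ _ _ X S s m k0 g n0 Ss hRE.
  rewrite big1 ?mulr_ge0 ?sumr_ge0//; first by case: hRE => _ _ _ /ltW.
  by move=> j; rewrite inE => jS; rewrite gSc// mxE normr0.
move=> N [N0 NK _ gN].
have N00 : N = 0.
  apply/eqP; rewrite -sqrf_eq0 eq_le sqr_ge0 andbT.
  by move: NK; rewrite Xg mul0r mulr0.
apply/rowP => k; rewrite mxE.
have -> : u ord0 k = g (enum_val k) ord0.
  by have /colP/(_ k) := gS; rewrite !mxE.
by apply/eqP; rewrite -normr_le0 -N00.
Qed.

Hypothesis Mu : (subcols S X)^T *m subcols S X \in unitmx.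

Lemma resid_orth : (subcols S X)^T *m resid_mx = 0.
Proof.
rewrite mulmxBr /irrep_mx !(trmx_mul, trmx_inv, trmxK) !mulmxA.
by rewrite mulmxV// mul1mx subrr.
Qed.

(** Pythagoras: an orthogonal projection does not increase norms. *)
Lemma resid_col_le k :
  \sum_(i < n) resid_mx i k ^+ 2 <= \sum_(i < n) X i (enum_val k) ^+ 2.
Proof.
pose B := subcols S X *m irrep_mx^T.
have XE : subcols (~: S) X = resid_mx + B by rewrite /resid_mx subrK.
have WB : resid_mx^T *m B = 0.
  by rewrite /B mulmxA -[_ *m subcols S X]trmxK trmx_mul trmxK resid_orth trmx0 mul0mx.
have BW : B^T *m resid_mx = 0 by rewrite -[LHS]trmxK trmx_mul trmxK WB trmx0.
have : ((subcols (~: S) X)^T *m subcols (~: S) X) k k =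
    (resid_mx^T *m resid_mx) k k + (B^T *m B) k k.
  rewrite XE [(_ + _)^T]linearD/= mulmxDl 2!(mulmxDr _ resid_mx B) WB BW.
  by rewrite addr0 add0r mxE.
have sq m' (A : 'M[R]_(n, m')) j : (A^T *m A) j j = \sum_i A i j ^+ 2.
  by rewrite mxE; apply: eq_bigr => i _; rewrite mxE expr2.
rewrite !sq => E.
under [leRHS]eq_bigr => i _.
  rewrite (_ : X i (enum_val k) = subcols (~: S) X i k); last by rewrite mxE.
  over.
by rewrite E lerDl sumr_ge0// => i _; exact: sqr_ge0.
Qed.

(** Off [S] the direction [v] is [g], and on [S] it is minus the regression of
    [X_{S^c} g_{S^c}] on the columns of [X_S]. Moving along [v] thus changes the
    fit only in directions orthogonal to [X_S], at a cost on [S] that [r_n]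
    controls. *)
Lemma resid_direction (g : 'cV[R]_p) : exists v : 'cV[R]_p,
  [/\ (forall j, j \notin S -> v j ord0 = g j ord0),
      X *m v = resid_mx *m subvec (~: S) g,
      (forall u : 'cV[R]_p, (forall j, j \notin S -> u j ord0 = 0) ->
        dot (X *m u) (X *m v) = 0) &
      \sum_(j in S) `|v j ord0| <= r_n X S * \sum_(j in ~: S) `|g j ord0|].
Proof.
have [v [vS vSc]] := extend_subvec (- (irrep_mx^T *m subvec (~: S) g)) g.
have vgc : subvec (~: S) v = subvec (~: S) g.
  by apply: eq_subvec => j; rewrite inE => /vSc.
have Xv : X *m v = resid_mx *m subvec (~: S) g.
  by rewrite (mulmx_split X S) vS vgc mulmxN mulmxA addrC -mulmxBl.
exists v; split => //.
- move=> u u0; rewrite Xv (mulmx_split X S) (_ : subvec (~: S) u = 0).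
    rewrite mulmx0 addr0.
    by rewrite dotC dot_mulmx mulmxA resid_orth mul0mx /dot trmx0 mul0mx mxE.
  by apply/colP => k; rewrite !mxE u0//; have := enum_valP k; rewrite inE.
- rewrite -!l1norm_subvec vS /l1norm.
  apply: (@le_trans _ _ (\sum_(k < #|S|) \sum_(j < #|~: S|)
      `|irrep_mx j k| * `|subvec (~: S) g j ord0|)).
    apply: ler_sum => k _; rewrite mxE normrN mxE (le_trans (ler_norm_sum _ _ _))//.
    by apply: ler_sum => j _; rewrite mxE normrM.
  rewrite exchange_big/= mulr_sumr; apply: ler_sum => j _.
  rewrite -mulr_suml ler_wpM2r// /r_n /max_row_sum -/irrep_mx.
  exact: (le_bigmax_cond _ (fun j => \sum_k `|irrep_mx j k|)).
Qed.

End residual_design.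

(** * First-order conditions for the weighted lasso *)

Section weighted_lasso.
Context (R : realType) (n p : nat) (X : 'M[R]_(n, p)).
Hypothesis n0 : (0 < n)%N.

(** Comparing [b] with [b - t *: v] gives [0 <= t * D + t ^ 2 * Q], where [D] is
    the right-hand side below and [Q] is a quadratic term. Bounding the penalty
    by the numbers [c j] instead of differentiating it keeps sign conditions
    out of the later arguments. *)
Lemma wlasso_first_order (y : 'cV[R]_n) (mu : R) (w : 'I_p -> \bar R)
    (b v : 'cV[R]_p) (c : 'I_p -> R) : 0 <= mu ->
  (forall j, 0 <= fine (w j)) -> is_wlasso X y mu w b ->
  (forall j, w j = +oo%E -> v j ord0 = 0) ->
  (forall t j, 0 < t -> t <= 1 ->
     `|b j ord0 - t * v j ord0| <= `|b j ord0| + t * c j) ->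
  0 <= dot (y - X *m b) (X *m v) / n%:R + mu * \sum_j fine (w j) * c j.
Proof.
move=> mu0 w0 [feas bmin] vfeas bc.
have nR0 : 0 < n%:R :> R by rewrite ltr0n.
set D := (X in 0 <= X); pose Q := dot (X *m v) (X *m v) / (2 * n%:R).
have Q0 : 0 <= Q by rewrite divr_ge0 ?dotvv_ge0 ?mulr_ge0// ltW.
have tDQ t : 0 < t -> t <= 1 -> 0 <= D + t * Q.
  move=> t0 t1; rewrite -(pmulr_rge0 _ t0).
  have /bmin : wfeasible w (b - t *: v).
    by move=> j wj; rewrite !mxE feas// vfeas// mulr0 subrr.
  rewrite /wlasso_obj.
  rewrite (_ : y - X *m (b - t *: v) = (y - X *m b) + t *: (X *m v)); last first.
    by rewrite mulmxBr scalemxAr opprB addrA addrAC.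
  rewrite /D; move: (y - X *m b) => r.
  rewrite !l2norm_sqr !dotDl !dotDr !dotZl !dotZr (dotC (X *m v)).
  have : \sum_j fine (w j) * `|(b - t *: v) j ord0| <=
     \sum_j fine (w j) * `|b j ord0| + t * \sum_j fine (w j) * c j.
    rewrite mulr_sumr -big_split/=; apply: ler_sum => j _.
    rewrite mulrCA -mulrDr; apply: ler_wpM2l; first exact: w0.
    by rewrite !mxE; exact: bc.
  move=> /(ler_wpM2l mu0); rewrite mulrDr => h1 h2.
  have := le_trans h2 (lerD (lexx _) h1); rewrite -subr_ge0 => h3.
  rewrite (_ : t * (_ + t * Q) = (2 * n%:R)^-1 *
     (dot r r + t * dot r (X *m v) +
      (t * dot r (X *m v) + t * (t * dot (X *m v) (X *m v)))) +
     (mu * (\sum_j fine (w j) * `|b j ord0|) + mu * (t * (\sum_j fine (w j) * c j)))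
     - ((2 * n%:R)^-1 * dot r r + mu * (\sum_j fine (w j) * `|b j ord0|)))//.
  by rewrite /Q; field; rewrite gt_eqF.
(* if [D < 0], the step [- D / (Q - D)] contradicts [tDQ] *)
rewrite leNgt; apply/negP => D0.
have QD : 0 < Q - D by lra.
have := tDQ (- D / (Q - D)) _ _.
rewrite divr_gt0 ?oppr_gt0// ler_pdivrMr// mul1r => /(_ isT).
have -> : D + - D / (Q - D) * Q = - (D ^+ 2 / (Q - D)) by field; rewrite gt_eqF.
have -> : - D <= Q - D by lra.
by move=> /(_ isT); rewrite oppr_ge0 leNgt divr_gt0// exprn_even_gt0//= lt_eqF.
Qed.

Lemma lasso_wlasso (y : 'cV[R]_n) (lam : R) (b : 'cV[R]_p) : is_lasso X y lam b ->
  is_wlasso X y lam (fun=> 1%:E) b.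
Proof.
move=> bmin; split => // b' _; have := bmin b'.
rewrite /lasso_obj /wlasso_obj /l1norm /=.
by under [in X in _ -> X]eq_bigr do rewrite mul1r;
   under [in X in _ -> _ <= _ + _ * X]eq_bigr do rewrite mul1r.
Qed.

Variables (beta : 'cV[R]_p) (e : 'cV[R]_n).
Let S := supp beta.
Let s := #|S|.
Let K := RE_K s s 3 X.
Let y := X *m beta + e.
Hypotheses (hRE : RE s s 3 X).
Variable (lam : R).
Hypotheses (lam0 : 0 < lam)
  (noise : forall v : 'cV[R]_p, dot e (X *m v) / n%:R <= lam / 2 * \sum_j `|v j ord0|).

Lemma beta_off j : j \notin S -> beta j ord0 = 0.
Proof. by rewrite inE negbK => /eqP. Qed.

Lemma resid_beta b : y - X *m b = e - X *m (b - beta).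
Proof. by rewrite /y mulmxBr opprB addrAC addrC. Qed.

Lemma l1_le_sqrt (g : 'cV[R]_p) N : 0 <= N ->
  \sum_(j in S) g j ord0 ^+ 2 <= N ^+ 2 ->
  \sum_(j in S) `|g j ord0| <= Num.sqrt s%:R * N.
Proof.
move=> N0 gN; rewrite -(@ler_pXn2r _ 2) ?nnegrE ?sumr_ge0 ?mulr_ge0//.
by rewrite exprMn sqr_sqrtr// (le_trans (l1_sqr_le _ _))// ler_wpM2l.
Qed.

(** Moving from [b] towards [beta] turns the l1 norms of [b] and [beta] into the
    increments [|beta j| - |b j|]. This yields the basic inequality
    [q <= 3/2 lam A - 1/2 lam B] between the prediction error [q] and the l1
    errors [A] on [S] and [B] off [S], whence the cone condition, and then
    [N ^ 2 <= K ^ 2 * q] closes the loop. *)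
Lemma lasso_error b : is_lasso X y lam b ->
  exists N : R, [/\ N <= 3 / 2 * (K ^+ 2 * (lam * Num.sqrt s%:R)),
    forall j, `|b j ord0 - beta j ord0| <= N &
    \sum_(j in ~: S) `|b j ord0| <= 9 / 2 * (K ^+ 2 * lam * s%:R)].
Proof.
move=> /lasso_wlasso bL; pose h := b - beta.
have nR0 : 0 < n%:R :> R by rewrite ltr0n.
have hE j : h j ord0 = b j ord0 - beta j ord0 by rewrite !mxE.
have hstep t j : 0 < t -> t <= 1 -> `|b j ord0 - t * h j ord0| <=
    `|b j ord0| + t * (`|beta j ord0| - `|b j ord0|).
  move=> t0 t1; rewrite hE.
  have -> : b j ord0 - t * (b j ord0 - beta j ord0) =
    (1 - t) * b j ord0 + t * beta j ord0 by ring.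
  rewrite (le_trans (ler_normD _ _))// !normrM (ger0_norm (ltW t0)).
  by rewrite ger0_norm ?subr_ge0//; lra.
have hfeas j : 1%:E = +oo%E :> \bar R -> h j ord0 = 0 by [].
have := wlasso_first_order (ltW lam0) (w := fun=> 1%:E) (fun=> ler01) bL
  hfeas hstep.
rewrite resid_beta -/h dotBl (sum_setC S) /=.
set A := \sum_(j in S) `|h j ord0|; set B := \sum_(j in ~: S) `|h j ord0|.
have BE : B = \sum_(j in ~: S) `|b j ord0|.
  by apply: eq_bigr => j; rewrite inE => jS; rewrite hE beta_off// subr0.
have c1 : \sum_(j in S) 1 * (`|beta j ord0| - `|b j ord0|) <= A.
  apply: ler_sum => j _; rewrite mul1r hE distrC; exact: lerB_dist.
have c2 : \sum_(j in ~: S) 1 * (`|beta j ord0| - `|b j ord0|) = - B.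
  rewrite BE -sumrN; apply: eq_bigr => j; rewrite inE => jS.
  by rewrite beta_off// normr0 mul1r sub0r.
have := noise h; rewrite (sum_setC S) -/A -/B c2 => nh fo.
set q := dot (X *m h) (X *m h) / n%:R.
have q0 : 0 <= q by rewrite divr_ge0 ?dotvv_ge0// ltW.
have fo' : 0 <= dot e (X *m h) / n%:R - q +
    lam * (\sum_(j in S) 1 * (`|beta j ord0| - `|b j ord0|) - B).
  by rewrite /q -mulrBl.
have c1' := ler_wpM2l (ltW lam0) c1.
have qAB : q <= 3 / 2 * (lam * A) - 1 / 2 * (lam * B) by nra.
have cone : B <= 3 * A.
  rewrite -(ler_pM2l lam0) (mulrCA lam); lra.
have [N [N0 NK hN hj]] := RE_cone n0 (erefl : #|S| = s) hRE cone.
have AN : A <= Num.sqrt s%:R * N by exact: l1_le_sqrt.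
set sq := Num.sqrt s%:R in AN *.
have sq0 : 0 <= sq by exact: sqrtr_ge0.
have B0 : 0 <= B by exact: sumr_ge0.
have NL : N <= 3 / 2 * (K ^+ 2 * (lam * sq)).
  have : N ^+ 2 <= N * (3 / 2 * (K ^+ 2 * (lam * sq))).
    apply: le_trans NK _; rewrite -/K -/q.
    rewrite (_ : N * _ = K ^+ 2 * (3 / 2 * (lam * (sq * N)))); last ring.
    apply: ler_wpM2l; first exact: sqr_ge0.
    apply: le_trans qAB _.
    have := ler_wpM2l (ltW lam0) AN; have := mulr_ge0 (ltW lam0) B0; lra.
  have [->|NN0] := eqVneq N 0.
    by move=> _; rewrite mulr_ge0// mulr_ge0 ?sqr_ge0// mulr_ge0// ltW.
  by rewrite expr2 ler_pM2l// lt_def NN0.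
exists N; split => //; first by move=> j; rewrite -hE.
rewrite -BE (le_trans cone)// (_ : 9 / 2 * _ =
    3 * (sq * (3 / 2 * (K ^+ 2 * (lam * sq))))).
  by rewrite ler_pM2l// (le_trans AN)// ler_wpM2l.
have -> : s%:R = sq ^+ 2 by rewrite sqr_sqrtr.
by field.
Qed.

(** Along the direction of [resid_direction] the penalty off [S] decreases at
    the rate [mu * w j * |b j|], while the noise and the penalty on [S] return
    at most [(nu + mu * wmax * r_n) * |b j|]. When the former rate is larger,
    every [b j] must vanish. *)
Lemma wlasso_off_support (mu wmax nu : R) (w : 'I_p -> \bar R) (b : 'cV[R]_p) :
  0 <= mu -> 0 <= wmax ->
  (forall j, 0 <= fine (w j)) ->
  (forall j, j \in S -> w j != +oo%E /\ fine (w j) <= wmax) ->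
  is_wlasso X y mu w b ->
  dot e (resid_mx X S *m subvec (~: S) b) / n%:R <=
    nu * \sum_(j in ~: S) `|b j ord0| ->
  (forall j, j \notin S -> w j != +oo%E ->
     nu + mu * wmax * r_n X S < mu * fine (w j)) ->
  forall j, j \notin S -> b j ord0 = 0.
Proof.
move=> mu0 wm0 w0 wS bL noiseW wSc.
have nR0 : 0 < n%:R :> R by rewrite ltr0n.
have Mu := gram_unit n0 (erefl : #|S| = s) hRE.
have [v [vSc Xv orth vS]] := resid_direction Mu b.
have vfeas j : w j = +oo%E -> v j ord0 = 0.
  move=> wj; have [jS|jS] := boolP (j \in S).
    by have [] := wS _ jS; rewrite wj eqxx.
  by rewrite vSc// bL.1.
(* off S the coordinates shrink by the factor 1 - t *)
pose c j := if j \in S then `|v j ord0| else - `|b j ord0|.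
have vstep t j : 0 < t -> t <= 1 ->
    `|b j ord0 - t * v j ord0| <= `|b j ord0| + t * c j.
  move=> t0 t1; rewrite /c; case: ifPn => jS.
    by rewrite (le_trans (ler_normB _ _))// normrM (ger0_norm (ltW t0)).
  rewrite vSc// (_ : b j ord0 - _ = (1 - t) * b j ord0); last ring.
  by rewrite normrM ger0_norm ?subr_ge0//; lra.
have := wlasso_first_order mu0 w0 bL vfeas vstep.
rewrite (resid_beta b) dotBl.
set q := dot (X *m v) (X *m v).
have q0 : 0 <= q by exact: dotvv_ge0.
have -> : dot (X *m (b - beta)) (X *m v) = q.
  rewrite -[b - beta](subrK v) mulmxDr dotDl orth ?add0r// => j jS.
  by rewrite !mxE beta_off// subr0 vSc// subrr.
rewrite (sum_setC S) => fo.
set B := \sum_(j in ~: S) `|b j ord0| in noiseW vS.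
have r0 : 0 <= r_n X S by rewrite /r_n /max_row_sum; exact: bigmax_ge_id.
have c1 : \sum_(j in S) fine (w j) * c j <= wmax * (r_n X S * B).
  apply: (@le_trans _ _ (wmax * \sum_(j in S) `|v j ord0|)); last exact: ler_wpM2l.
  rewrite mulr_sumr; apply: ler_sum => j jS; rewrite /c jS.
  by apply: ler_wpM2r => //; case: (wS j jS).
have key : \sum_(j in ~: S)
    (mu * fine (w j) - nu - mu * wmax * r_n X S) * `|b j ord0| <= 0.
  under eq_bigr do rewrite -addrA mulrDl.
  rewrite big_split/= -mulr_sumr -/B.
  have -> : \sum_(j in ~: S) mu * fine (w j) * `|b j ord0| =
    - (mu * \sum_(j in ~: S) fine (w j) * c j).
    rewrite mulr_sumr -sumrN; apply: eq_bigr => j; rewrite inE /c => /negbTE ->.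
    ring.
  move: fo; rewrite Xv mulrBl mulrDr => fo.
  have := ler_wpM2l mu0 c1; have := divr_ge0 q0 (ltW nR0); lra.
move=> j jS; apply/eqP; apply: contraT => bj.
have term i : i \in ~: S ->
    0 <= (mu * fine (w i) - nu - mu * wmax * r_n X S) * `|b i ord0|.
  rewrite inE => iS; have [->|bi] := eqVneq (b i ord0) 0; first by rewrite normr0 mulr0.
  apply: mulr_ge0 => //; have := wSc i iS; rewrite -subr_gt0 opprD addrA => h.
  by apply/ltW/h; apply: contra bi => /eqP wi; rewrite bL.1.
move: key; rewrite (bigD1 j) ?finset.in_setC//= leNgt => /negP[].
rewrite ltr_pwDl//; last by apply: sumr_ge0 => i /andP[iS _]; exact: term.
rewrite mulr_gt0 ?normr_gt0//.
have := wSc j jS; rewrite -subr_gt0 opprD addrA; apply.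
by apply: contra bj => /eqP wi; rewrite bL.1.
Qed.

(** The direction is the error itself. It is supported on [S], so that the cone
    condition of [RE_cone] holds trivially, and only the noise and the weights
    on [S] oppose the restricted eigenvalue. *)
Lemma wlasso_on_support (mu wmax : R) (w : 'I_p -> \bar R) (b : 'cV[R]_p) :
  0 <= mu -> 0 <= wmax ->
  (forall j, 0 <= fine (w j)) ->
  (forall j, j \in S -> w j != +oo%E /\ fine (w j) <= wmax) ->
  is_wlasso X y mu w b -> (forall j, j \notin S -> b j ord0 = 0) ->
  forall j, `|b j ord0 - beta j ord0| <=
    K ^+ 2 * (Num.sqrt s%:R * (lam / 2 + mu * wmax)).
Proof.
move=> mu0 wm0 w0 wS bL bSc; pose g := b - beta.
have nR0 : 0 < n%:R :> R by rewrite ltr0n.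
have gE j : g j ord0 = b j ord0 - beta j ord0 by rewrite !mxE.
have gSc j : j \notin S -> g j ord0 = 0.
  by move=> jS; rewrite gE bSc// beta_off// subrr.
have gfeas j : w j = +oo%E -> g j ord0 = 0.
  move=> wj; apply: gSc; apply/negP => jS.
  by have [] := wS _ jS; rewrite wj eqxx.
have gstep t j : 0 < t -> t <= 1 ->
    `|b j ord0 - t * g j ord0| <= `|b j ord0| + t * `|g j ord0|.
  move=> t0 t1.
  by rewrite (le_trans (ler_normB _ _))// normrM (ger0_norm (ltW t0)).
have := wlasso_first_order mu0 w0 bL gfeas gstep.
rewrite (resid_beta b) -/g dotBl.
have Sc0 (F : 'I_p -> R) : \sum_(j in ~: S) F j * `|g j ord0| = 0.
  by rewrite big1// => j; rewrite inE => /gSc ->; rewrite normr0 mulr0.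
rewrite (sum_setC S) Sc0 addr0.
set A := \sum_(j in S) `|g j ord0|.
have gA : \sum_j `|g j ord0| = A.
  rewrite (sum_setC S); have := Sc0 (fun=> 1).
  by under eq_bigr do rewrite mul1r; move=> ->; rewrite addr0.
have := noise g; rewrite gA mulrBl.
set q := dot (X *m g) (X *m g) / n%:R => ng fo.
have c1 : \sum_(j in S) fine (w j) * `|g j ord0| <= wmax * A.
  rewrite mulr_sumr; apply: ler_sum => j jS.
  by apply: ler_wpM2r => //; case: (wS j jS).
have cone : \sum_(j in ~: S) `|g j ord0| <= 3 * A.
  rewrite big1 ?mulr_ge0 ?sumr_ge0// => j; rewrite inE => /gSc ->.
  by rewrite normr0.
have [N [N0 NK hN hj]] := RE_cone n0 (erefl : #|S| = s) hRE cone.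
have AN : A <= Num.sqrt s%:R * N by exact: l1_le_sqrt.
have qA : q <= (lam / 2 + mu * wmax) * A.
  have := ler_wpM2l mu0 c1; lra.
have lm0 : 0 <= lam / 2 + mu * wmax by rewrite addr_ge0 ?mulr_ge0 ?divr_ge0 ?(ltW lam0).
suff NL : N <= K ^+ 2 * (Num.sqrt s%:R * (lam / 2 + mu * wmax)).
  by move=> j; rewrite -gE (le_trans (hj j)).
have : N ^+ 2 <= N * (K ^+ 2 * (Num.sqrt s%:R * (lam / 2 + mu * wmax))).
  apply: le_trans NK _; rewrite -/K -/q.
  rewrite [leRHS]mulrCA; apply: ler_wpM2l; first exact: sqr_ge0.
  apply: le_trans qA _.
  rewrite (_ : N * _ = (lam / 2 + mu * wmax) * (Num.sqrt s%:R * N)); last ring.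
  exact: ler_wpM2l.
have [->|NN0] := eqVneq N 0.
  by move=> _; rewrite mulr_ge0 ?sqr_ge0// mulr_ge0 ?sqrtr_ge0.
by rewrite expr2 ler_pM2l// lt_def NN0.
Qed.

End weighted_lasso.

(** * Support recovery by the adaptive lasso *)

Section support_recovery.
Context (R : realType) (n p : nat) (X : 'M[R]_(n, p)).
Variables (beta : 'cV[R]_p) (e : 'cV[R]_n).
Let S := supp beta.
Let s := #|S|.
Let K := RE_K s s 3 X.
Let y := X *m beta + e.
Variables (lam nu rt bm mu : R) (binit bhat : 'cV[R]_p).
Let q := Num.sqrt s%:R : R.
Let u := K ^+ 2 * (lam * q).
Let sb := Num.sqrt (s_bar lam binit)%:R : R.
Hypotheses (n0 : (0 < n)%N) (hRE : RE s s 3 X) (K1 : 1 <= K) (lam0 : 0 < lam)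
  (noise : forall v : 'cV[R]_p,
     dot e (X *m v) / n%:R <= lam / 2 * \sum_j `|v j ord0|)
  (noiseW : forall b : 'cV[R]_p,
     dot e (resid_mx X S *m subvec (~: S) b) / n%:R <=
     nu * \sum_(j in ~: S) `|b j ord0|)
  (Linit : is_lasso X y lam binit)
  (Lhat : is_wlasso X y mu (adaptive_weight binit) bhat)
  (r_rt : r_n X S <= rt) (rt_u : rt * u <= 1 / 32)
  (bm_beta : forall j, j \in S -> bm <= `|beta j ord0|)
  (bm_u : 36 * u <= bm) (rt_bm : rt * u <= bm / 32).

Let s_ge1 : 1 <= s%:R :> R.
Proof. by case: hRE => [[s1 _] _ _ _ _]; rewrite ler1n. Qed.

Let q_ge1 : 1 <= q.
Proof. by rewrite -[leLHS]sqrtr1 ler_wsqrtr. Qed.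

Let u_gelam : lam <= u.
Proof.
rewrite -[leLHS]mul1r /u; apply: ler_pM => //; first exact: ltW.
  exact: exprn_ege1.
by rewrite ler_peMr// ltW.
Qed.

Let u0 : 0 < u. Proof. exact: lt_le_trans lam0 u_gelam. Qed.

Let bm0 : 0 < bm. Proof. by apply: lt_le_trans bm_u; rewrite mulr_gt0. Qed.

Let r0 : 0 <= r_n X S.
Proof. exact: bigmax_ge_id. Qed.

Lemma init_off_small j : j \notin S -> `|binit j ord0| <= 3 / 2 * u.
Proof.
move=> jS; have [N [NL hj _]] := lasso_error n0 hRE lam0 noise Linit.
by have := hj j; rewrite (beta_off jS) subr0 => /le_trans; apply.
Qed.

Lemma init_on_large j : j \in S -> 23 / 24 * bm <= `|binit j ord0|.
Proof.
move=> jS; have [N [NL hj _]] := lasso_error n0 hRE lam0 noise Linit.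
have NL' : N <= 3 / 2 * u by [].
have := bm_beta jS; have := hj j; rewrite distrC => h1 h2.
have := lerB_dist (beta j ord0) (binit j ord0); have := bm_u; lra.
Qed.

Lemma init_on_gt j : j \in S -> 4 * lam < `|binit j ord0|.
Proof.
move=> jS; apply: lt_le_trans (init_on_large jS).
have := u_gelam; have := bm_u; have := lam0; lra.
Qed.

Lemma s_bar_ge : q <= sb.
Proof.
rewrite ler_wsqrtr// ler_nat subset_leq_card//; apply/fintype.subsetP => j jS.
by rewrite inE init_on_gt.
Qed.

(** Each coordinate counted off [S] costs [4 * lam] of the l1 error off [S]. *)
Lemma s_bar_le : sb <= 3 / 2 * (K * q).
Proof.
have [N [_ _ hB]] := lasso_error n0 hRE lam0 noise Linit.
have K0 : 0 <= K by rewrite (le_trans ler01).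
have rhs0 : 0 <= 3 / 2 * (K * q) by rewrite mulr_ge0// mulr_ge0// sqrtr_ge0.
rewrite -(@ler_pXn2r _ 2) ?nnegrE ?sqrtr_ge0// sqr_sqrtr// !exprMn sqr_sqrtr//.
pose F := [set j in ~: S | 4 * lam < `|binit j ord0|]%SET.
have sF : (s_bar lam binit <= s + #|F|)%N.
  apply: leq_trans (leq_card_setU S F); apply: subset_leq_card.
  apply/fintype.subsetP => j; rewrite !inE => ->; rewrite andbT orbN//.
have FB : 4 * lam * #|F|%:R <= \sum_(j in ~: S) `|binit j ord0|.
  rewrite [leRHS](big_setID F)/= mulr_natr -sumr_const.
  rewrite (finset.setIidPr _); last first.
    by apply/fintype.subsetP => j; rewrite !inE => /andP[].
  apply: ler_wpDr; first exact: sumr_ge0.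
  by apply: ler_sum => j; rewrite !inE => /andP[_ /ltW].
have FK : #|F|%:R <= 9 / 8 * (K ^+ 2 * s%:R).
  rewrite -(ler_pM2l lam0); have := le_trans FB hB; rewrite -/s -/K.
  rewrite (_ : K ^+ 2 * lam * s%:R = lam * (K ^+ 2 * s%:R)); last ring.
  rewrite -mulrA (mulrCA lam (9 / 8)); lra.
have : (s_bar lam binit)%:R <= (s + #|F|)%:R :> R by rewrite ler_nat.
rewrite natrD => h.
have sK : s%:R <= K ^+ 2 * s%:R by rewrite ler_peMl// exprn_ege1.
rewrite (_ : 3 ^+ 2 * _ ^+ 2 = 9 / 4 :> R); last by field.
have : 0 <= s%:R :> R by []. lra.
Qed.

(** For small [rt] the initial estimator vanishes off [S]: with unit weights,
    [wlasso_off_support] asks for [(1 + r) / 2 + r < 1]. *)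
Lemma s_bar_le_small : rt < 1 / 4 -> sb <= q.
Proof.
move=> rt4; rewrite ler_wsqrtr// ler_nat; apply: subset_leq_card.
have Mu := gram_unit n0 (erefl : #|S| = s) hRE.
have off : forall j, j \notin S -> binit j ord0 = 0.
  apply: (@wlasso_off_support R n p X n0 beta e hRE lam 1 (lam / 2 * (1 + r_n X S))
    (fun=> 1%:E)) => //.
  - exact: ltW.
  - exact: lasso_wlasso.
  - have [v [vSc Xv _ vS]] := resid_direction Mu binit.
    rewrite -/S -Xv (le_trans (noise v))// (sum_setC S) -[leRHS]mulrA.
    apply: ler_wpM2l; first by rewrite divr_ge0// ltW.
    rewrite mulrDl mul1r addrC lerD//.
    by apply: ler_sum => j; rewrite inE => /vSc ->.
  - move=> j jS _ /=; rewrite -/S mulr1.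
    have := r_rt; rewrite -(ler_pM2l lam0) => h1.
    have := rt4; rewrite -(ltr_pM2l lam0) => h2.
    have := lam0; lra.
apply/fintype.subsetP => j; rewrite inE => h; apply: contraT => jS.
by move: h; rewrite off// normr0 ltNge mulr_ge0// ltW.
Qed.

(** A bound for the weights on [S], the inverse of the bound of
    [init_on_large]. *)
Let wmax := Num.max 1 (24 / 23 / bm).

Let wmax0 : 0 <= wmax. Proof. by rewrite le_max ler01. Qed.

Let w_ge0 j : 0 <= fine (adaptive_weight binit j).
Proof.
by rewrite /adaptive_weight; case: ifP => //= _; rewrite le_max ler01 orbT.
Qed.

Let w_on j : j \in S -> adaptive_weight binit j != +oo%E /\
  fine (adaptive_weight binit j) <= wmax.
Proof.
move=> jS; have bj := init_on_large jS.
have b0 : 0 < `|binit j ord0| by apply: lt_le_trans bj; rewrite mulr_gt0.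
rewrite /adaptive_weight; have := b0; rewrite normr_gt0 => /negbTE -> /=.
split => //.
rewrite ge_max; apply/andP; split; last by rewrite le_max lexx.
rewrite le_max; apply/orP; right.
rewrite ler_pdivrMr// mulrAC ler_pdivlMr//; lra.
Qed.

Let w_off j : j \notin S -> adaptive_weight binit j != +oo%E ->
  2 / 3 <= fine (adaptive_weight binit j) * u.
Proof.
move=> jS; have bj := init_off_small jS; rewrite /adaptive_weight.
have [//|b0 _] := eqVneq (binit j ord0) 0.
have b0' : 0 < `|binit j ord0| by rewrite normr_gt0.
rewrite /=; apply: (@le_trans _ _ (1 / `|binit j ord0| * u)).
  by rewrite mulrAC ler_pdivlMr//; lra.
by rewrite ler_pM2r// le_max lexx.
Qed.

Let r_wmax : r_n X S * wmax * u <= 1 / 24.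
Proof.
have ru : r_n X S * u <= rt * u by rewrite ler_pM2r.
rewrite mulrAC /wmax; have [h|h] := leP 1 (24 / 23 / bm).
  rewrite mulrA ler_pdivrMr//; have := rt_bm; have := bm0; lra.
have := rt_u; lra.
Qed.

(** Off [S], the lower bound on [mu] makes the penalty exceed twice the noise
    level [nu]. On [S], the error is at most [u / 2 + x * bm * wmax] with
    [x = lam / 2 * K * sb]. For [wmax = 24 / 23 / bm] the bound [x <= 3/4 * u]
    suffices. For [wmax = 1] one uses [x <= 1/4], which is the last hypothesis
    when [sb <= q], that is for small [rt], and follows from [u <= 1/8]
    otherwise. *)
Lemma adaptive_lasso_support :
  0 < nu ->
  10 * (K ^+ 2 * lam * sb * nu) <= mu ->
  mu * K * q <= lam / 2 * bm * sb ->
  lam / 2 * K * q <= 1 / 4 ->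
  supp bhat = supp beta.
Proof.
move=> nu0 mu_lo mu_hi small.
have K0 : 0 < K by rewrite (lt_le_trans ltr01).
have mu_u : 10 * (u * nu) <= mu.
  apply: le_trans mu_lo; rewrite /u.
  have := s_bar_ge; rewrite -(ler_pM2l (_ : 0 < K ^+ 2 * lam * nu)); last first.
    by rewrite !mulr_gt0// exprn_gt0.
  rewrite (_ : K ^+ 2 * (lam * q) * nu = K ^+ 2 * lam * nu * q); last ring.
  rewrite (_ : K ^+ 2 * lam * sb * nu = K ^+ 2 * lam * nu * sb); last ring.
  lra.
have mu0 : 0 < mu by apply: lt_le_trans mu_u; rewrite mulr_gt0//; apply: mulr_gt0.
have off : forall j, j \notin S -> bhat j ord0 = 0.
  apply: (wlasso_off_support n0 hRE (ltW mu0) wmax0 w_ge0 w_on Lhat (noiseW bhat)).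
  move=> j jS wj; rewrite -/S; set w := fine _.
  have wu := w_off jS wj; rewrite -/w in wu.
  rewrite -(ltr_pM2r u0).
  have h1 : mu * (r_n X S * wmax * u) <= mu * (1 / 24) by rewrite ler_pM2l.
  have h2 : mu * (2 / 3) <= mu * (w * u) by rewrite ler_pM2l.
  rewrite (_ : mu * w * u = mu * (w * u)); last ring.
  rewrite (_ : (nu + _) * u = u * nu + mu * (r_n X S * wmax * u)); last ring.
  have := mulr_gt0 u0 nu0; lra.
have on := wlasso_on_support n0 hRE lam0 noise (ltW mu0) wmax0 w_ge0 w_on Lhat off.
suff bnd : K ^+ 2 * (q * (lam / 2 + mu * wmax)) < bm.
  apply/setP => j; rewrite -/S; have [jS|jS] := boolP (j \in S).
    rewrite inE; apply/eqP => b0; have := on j; rewrite b0 sub0r normrN.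
    move=> /le_lt_trans/(_ bnd); rewrite ltNge => /negP; apply.
    exact: bm_beta.
  by rewrite inE off// eqxx.
pose x := lam / 2 * K * sb.
have x1 : x <= 3 / 4 * u.
  have := s_bar_le; rewrite -(ler_pM2l (_ : 0 < lam / 2 * K)); last first.
    by rewrite !mulr_gt0// invr_gt0.
  rewrite -/x => h; apply: le_trans h _.
  by rewrite (_ : lam / 2 * K * _ = 3 / 4 * u)//; rewrite /u; field.
have x2 : x <= 1 / 4.
  have [/s_bar_le_small h|h] := ltP rt (1 / 4).
    apply: le_trans small; rewrite /x ler_pM2l//.
    by rewrite !mulr_gt0// invr_gt0.
  have := rt_u; have : 1 / 4 * u <= rt * u by rewrite ler_pM2r.
  have := x1; have := u0; lra.
have xb : K ^+ 2 * q * mu <= x * bm.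
  rewrite (_ : K ^+ 2 * q * mu = K * (mu * K * q)); last ring.
  rewrite (_ : x * bm = K * (lam / 2 * bm * sb)); last by rewrite /x; ring.
  by rewrite ler_pM2l.
rewrite (_ : K ^+ 2 * _ = u / 2 + K ^+ 2 * q * mu * wmax); last first.
  by rewrite /u; field.
have xbw : K ^+ 2 * q * mu * wmax <= x * bm * wmax by rewrite ler_wpM2r.
apply: (@le_lt_trans _ _ (u / 2 + x * bm * wmax)); first by rewrite lerD2l.
have := bm_u; rewrite /wmax; have [h|h] := leP 1 (24 / 23 / bm).
  rewrite (_ : x * bm * _ = 24 / 23 * x); last by field; rewrite gt_eqF.
  have := u0; lra.
have : x * bm <= 1 / 4 * bm by rewrite ler_pM2r.
have := u0; lra.
Qed.

End support_recovery.

(** * The adaptive lasso with Gaussian noise *)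

Lemma sqrt_noise_level (R : realType) (sigma a l m : R) : 0 <= a -> 0 <= l -> 0 < m ->
  sigma * Num.sqrt m * Num.sqrt (a * l) / m = Num.sqrt a * (sigma * Num.sqrt (l / m)).
Proof.
move=> a0 l0 m0; rewrite sqrtrM// (sqrtrM _ l0) sqrtrV ?ltW//.
have sm0 : Num.sqrt m != 0 by rewrite gt_eqF ?sqrtr_gt0.
rewrite -[in X in _ / X](sqr_sqrtr (ltW m0)).
by field.
Qed.

(** Since [p - s >= 2], one has [p <= 2 * (p - s) <= (p - s) ^ 2]. *)
Lemma ln_le_2ln_subn (R : realType) (p s : nat) : (2 * s <= p)%N ->
  0 < ln (p - s)%N%:R :> R -> ln p%:R <= 2 * ln (p - s)%N%:R :> R.
Proof.
move=> sp l0.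
have ps2 : (1 < p - s)%N.
  rewrite ltnNge; apply/negP => h; move: l0; rewrite ltNge => /negP; apply.
  by apply: ln_le0; move: h; rewrite -(ler_nat R).
have p0 : 0 < (p - s)%N%:R :> R by rewrite ltr0n ltnW.
rewrite [leRHS]mulr_natl -lnXn// ler_ln ?posrE ?exprn_gt0//; last first.
  by rewrite ltr0n (leq_trans _ (leq_subr s p))// ltnW.
rewrite -natrX ler_nat (@leq_trans (2 * (p - s)))//.
  by rewrite mulnBr; lia.
by rewrite expnS expn1 leq_mul2r ps2 orbT.
Qed.

(** Since [ln (p - s) <= ln p <= 2 * ln (p - s)], replacing [ln (p - s)] by
    [ln p] in the two-sided condition on the tuning parameter costs a factor
    [sqrt 2], the quotient of [sqrt 6] by [sqrt 3]. The positive lower bound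
    [lo] also excludes the degenerate case [ln (p - s) = 0], where the square
    root in the condition is [0]. *)
Lemma tuning_ratio_bounds (R : realType) (sigma lam m lnp lnps tau mu sb lo hi : R) :
  0 < sigma -> 0 < lam -> 0 < m -> 0 < lo -> 0 <= sb ->
  tau = sigma * Num.sqrt (lnp / m) -> 0 < lnp ->
  (0 < lnps -> lnp <= 2 * lnps) -> lnps <= lnp ->
  lo <= mu / (sigma * lam * sb) * Num.sqrt (m / (2 * lnps)) <= hi ->
  lo * (lam * sb * tau) <= mu /\
  Num.sqrt 3 * mu <= hi * (lam * sb * (Num.sqrt 6 * tau)).
Proof.
move=> sigma0 lam0 n0 lo0 sb0 tauE l10 l12 l21 /andP[hlo hhi].
set z := sigma * lam * sb in hlo hhi; set D := Num.sqrt (m / (2 * lnps)) in hlo hhi.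
have r0 : 0 < mu / z * D by apply: lt_le_trans hlo.
have D0 : 0 < D.
  by rewrite lt_def sqrtr_ge0 andbT; apply: contraTneq r0 => ->; rewrite mulr0 ltxx.
have l20 : 0 < lnps.
  by move: D0; rewrite sqrtr_gt0 pmulr_rgt0// invr_gt0 pmulr_rgt0.
have z0 : 0 < z.
  rewrite lt_def; apply/andP; split; last by rewrite /z !mulr_ge0// ltW.
  by apply: contraTneq r0 => ->; rewrite invr0 mulr0 mul0r ltxx.
have sb0' : 0 < sb by move: z0; rewrite /z pmulr_rgt0// mulr_gt0.
pose rho := sigma / D.
have rho0 : 0 < rho by rewrite divr_gt0.
have muE : mu = mu / z * D * (lam * sb * rho).
  by rewrite /rho /z; field; rewrite !gt_eqF.
have tau0 : 0 <= tau by rewrite tauE mulr_ge0 ?sqrtr_ge0// ltW.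
have D2 : D ^+ 2 = m / (2 * lnps) by rewrite sqr_sqrtr// divr_ge0 ?mulr_ge0// ltW.
have rho2 : rho ^+ 2 = 2 * lnps * (sigma ^+ 2 / m).
  by rewrite /rho exprMn exprVn D2; field; rewrite !gt_eqF.
have tau2 : tau ^+ 2 = lnp * (sigma ^+ 2 / m).
  by rewrite tauE exprMn sqr_sqrtr ?divr_ge0 ?ltW//; field; rewrite gt_eqF.
have sn0 : 0 < sigma ^+ 2 / m by rewrite divr_gt0// exprn_gt0.
have tau_rho : tau <= rho.
  rewrite -(@ler_pXn2r _ 2) ?nnegrE ?(ltW rho0)// tau2 rho2 ler_pM2r//.
  exact: l12.
have rho_tau : Num.sqrt 3 * rho <= Num.sqrt 6 * tau.
  have a1 : 0 <= Num.sqrt 3 * rho by apply: mulr_ge0; rewrite ?sqrtr_ge0// ltW.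
  have a2 : 0 <= Num.sqrt 6 * tau by apply: mulr_ge0; rewrite ?sqrtr_ge0.
  rewrite -(@ler_pXn2r _ 2) ?nnegrE//.
  rewrite [(_ * rho) ^+ 2]exprMn [(_ * tau) ^+ 2]exprMn !sqr_sqrtr// tau2 rho2.
  have := ler_wpM2r (ltW sn0) l21; lra.
have ls0 : 0 < lam * sb by rewrite mulr_gt0.
split.
  rewrite [leRHS]muE; apply: ler_pM => //; first exact: ltW.
    by rewrite mulr_ge0// ltW.
  by rewrite ler_pM2l.
rewrite [in leLHS]muE (_ : Num.sqrt 3 * _ =
  mu / z * D * (lam * sb * (Num.sqrt 3 * rho))); last ring.
apply: ler_pM => //; first exact: ltW.
  by apply: mulr_ge0; [exact: ltW | apply: mulr_ge0; [exact: sqrtr_ge0 | exact: ltW]].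
by rewrite ler_pM2l.
Qed.

Theorem theorem4p3 (d : measure_display) (T : measurableType d) (R : realType)
    (P : probability T R) (n p : nat) (X : 'M[R]_(n, p)) (beta : 'cV[R]_p)
    (sigma : R) (eps : 'I_n -> {RV P >-> R})
    (Y : T -> 'cV[R]_n)
    (beta_init beta_hat : T -> 'cV[R]_p) (lambda_n : T -> R)
    (eta M rtilde : R) :
  let S := supp beta in
  let s := #|S| in
  let K := RE_K s s 3 X in
  let lam_init := lambda_init n p sigma in
  let eps_vec := fun t : T => \col_(i < n) (eps i t : R) in
  let TT : set T := [set t : T | `| n%:R^-1 *: (X^T *m eps_vec t) |
                       <= sigma * Num.sqrt (6 * ln p%:R / n%:R)] in
  (n <= p)%N ->
  0 < sigma ->
  gaussian_noise sigma eps ->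
  (forall t : T, Y t = X *m beta + eps_vec t) ->
  (forall j : 'I_p, l2norm (col j X) <= Num.sqrt n%:R) ->
  RE s s 3 X ->
  (forall t : T, is_lasso X (Y t) lam_init (beta_init t)) ->
  0 < eta < 1 ->
  4 * K / eta <= M ->
  M <= Num.sqrt (Lambda_min X s) / ((1 - eta) * sigma)
       * Num.sqrt (n%:R / (2 * ln p%:R)) ->
  (forall t : T, TT t ->
     let sbar := s_bar lam_init (beta_init t) in
     let ratio := lambda_n t / (sigma * lam_init * Num.sqrt sbar%:R)
                  * Num.sqrt (n%:R / (2 * ln (p - s)%N%:R)) in
     64 * K ^+ 2 / eta <= ratio <= 16 * M * K) ->
  r_n X S <= rtilde ->
  s%:R < n%:R / (96 * sigma ^+ 2 * K ^+ 2 * ln p%:R) ->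
  rtilde * Num.sqrt s%:R <= (1 - eta) / (32 * K ^+ 2 * lam_init) ->
  Num.max (2 * rtilde / (1 - eta)) (M / Num.sqrt 3)
    * 16 * K ^+ 2 * lam_init * Num.sqrt s%:R < beta_min beta ->
  (forall t : T, is_wlasso X (Y t) (lambda_n t)
                   (adaptive_weight (beta_init t)) (beta_hat t)) ->
  with_prob_ge P (1 - 2 / p%:R ^+ 2)
    [set t : T | supp (beta_hat t) = supp beta].
Proof.
move=> S s K lam_init eps_vec TT np sigma0 Geps HY colX hRE Linit /andP[eta0 eta1].
move=> M_lo _ ratio r_rt s_small rt_q bmin Lhat.
have [[s1 sp] _ _ _ _] := hRE.
have n0 : (0 < n)%N.
  rewrite lt0n; apply/eqP => n00; move: s_small; rewrite n00 mul0r ltNge => /negP.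
  by apply.
have p1 : (1 < p)%N by rewrite (leq_trans _ sp)// -[2%N]muln1 leq_mul2l s1.
have nR0 : 0 < n%:R :> R by rewrite ltr0n.
have p0 : 0 < p%:R :> R by rewrite ltr0n ltnW.
have lnp0 : 0 < ln p%:R :> R by rewrite ln_gt0// ltr1n.
have K1 : 1 <= K by exact: RE_K_ge1 n0 hRE colX.
have K0 : 0 < K by rewrite (lt_le_trans ltr01).
pose tau := sigma * Num.sqrt (ln p%:R / n%:R).
have tau0 : 0 < tau by rewrite mulr_gt0// sqrtr_gt0 divr_gt0.
have lamE : lam_init = 2 * (Num.sqrt 6 * tau).
  rewrite /lam_init /lambda_init (_ : 24 = 2 ^+ 2 * 6 :> R); last by ring.
  by rewrite sqrtrM ?sqr_ge0// sqrtr_sqr ger0_norm// /tau; ring.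
have lam0 : 0 < lam_init.
  by rewrite lamE mulr_gt0// mulr_gt0// sqrtr_gt0.
have lam2 : lam_init / 2 = Num.sqrt 6 * tau by rewrite lamE; field.
have colX2 j : \sum_(i < n) X i j ^+ 2 <= n%:R.
  have := colX j; rewrite -(@ler_pXn2r _ 2) ?nnegrE ?l2norm_ge0 ?sqrtr_ge0//.
  rewrite l2norm_sqr dotE sqr_sqrtr ?ler0n//.
  by under eq_bigr do rewrite mxE -expr2.
have Mu := gram_unit n0 (erefl : #|S| = s) hRE.
have [A [mA PA hA]] := @gaussian_lin_good_event d T R P n sigma eps sigma0 Geps p
  #|~: S| (fun j i => X i j) (fun k i => resid_mx X S i k) n%:R p1
  (leq_trans (max_card _) (eq_leq (card_ord p))) nR0 colX2
  (fun k => le_trans (resid_col_le Mu k) (colX2 _)).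
exists A; split => // t /hA[h1 h2] /=.
pose e := eps_vec t.
have level a z : 0 <= a ->
    `|z| <= sigma * Num.sqrt n%:R * Num.sqrt (a * ln p%:R) ->
    `|n%:R^-1 * z| <= Num.sqrt a * tau.
  move=> a0 za; rewrite normrM ger0_norm ?invr_ge0 ?ler0n// mulrC.
  by rewrite -(sqrt_noise_level sigma a0 (ltW lnp0) nR0) ler_pM2r ?invr_gt0.
have sup1 j : `|(n%:R^-1 *: (X^T *m e)) j ord0| <= lam_init / 2.
  rewrite mxE lam2; apply: level => //.
  by rewrite mxE; under eq_bigr do rewrite !mxE; exact: h1.
have sup2 k : `|(n%:R^-1 *: ((resid_mx X S)^T *m e)) k ord0| <= 6 * tau.
  rewrite (_ : 6 = Num.sqrt 36 :> R); last first.
    by rewrite (_ : 36 = 6 ^+ 2 :> R) ?sqrtr_sqr ?ger0_norm//; ring.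
  rewrite mxE; apply: level => //.
  by rewrite mxE; under eq_bigr do rewrite [_^T _ _]mxE [e _ _]mxE; exact: h2.
have TTt : TT t.
  rewrite /TT /= -mulrA sqrtrM// mulrCA -/tau -lam2 /Num.norm/= mx_normrE.
  apply: bigmax_le => [|[j k] _]; first by rewrite divr_ge0// ltW.
  by rewrite /= (ord1 k); exact: sup1.
have noise (v : 'cV[R]_p) :
    dot e (X *m v) / n%:R <= lam_init / 2 * \sum_j `|v j ord0|.
  by rewrite mulrC dot_mulmx -dotZl; exact: dot_le_sup_l1.
have noiseW (b : 'cV[R]_p) :
    dot e (resid_mx X S *m subvec (~: S) b) / n%:R <=
    6 * tau * \sum_(j in ~: S) `|b j ord0|.
  rewrite mulrC dot_mulmx -dotZl -l1norm_subvec; exact: dot_le_sup_l1.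
pose q := Num.sqrt s%:R : R; pose u := K ^+ 2 * (lam_init * q).
have s0 : 0 < s%:R :> R by rewrite ltr0n.
have q0 : 0 < q by rewrite sqrtr_gt0.
have u0 : 0 < u.
  by apply: mulr_gt0; [exact: exprn_gt0 | exact: mulr_gt0].
have M4 : 4 <= M.
  apply: le_trans M_lo; rewrite ler_pdivlMr//; lra.
have [bm1 bm2] : 2 * rtilde / (1 - eta) * 16 * u <= beta_min beta /\
    M / Num.sqrt 3 * 16 * u <= beta_min beta.
  have maxE (x : R) : x * 16 * K ^+ 2 * lam_init * Num.sqrt s%:R = x * (16 * u).
    by rewrite /u /q; ring.
  move: bmin; rewrite maxE => /ltW bmin.
  have u16 : 0 < 16 * u by rewrite mulr_gt0.
  by split; apply: le_trans bmin;
    rewrite -[leLHS]mulrA (ler_pM2r u16) le_max lexx ?orbT.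
have bm_u : 36 * u <= beta_min beta.
  apply: le_trans bm2; rewrite ler_pM2r// mulrAC ler_pdivlMr ?sqrtr_gt0//.
  (* 16 * M / sqrt 3 >= 64 / sqrt 3 > 36 *)
  have : Num.sqrt 3 <= 16 / 9 :> R.
    by rewrite -[leRHS]ger0_norm// -sqrtr_sqr ler_wsqrtr//; lra.
  lra.
have bm0 : 0 < beta_min beta.
  by apply: lt_le_trans bm_u; rewrite mulr_gt0.
have := ratio t TTt; rewrite /= -/s => rat.
set sb := Num.sqrt (s_bar lam_init (beta_init t))%:R in rat.
have [mu_lo mu_hi] : 64 * K ^+ 2 * (lam_init * sb * tau) <= lambda_n t /\
    Num.sqrt 3 * lambda_n t <=
    16 * M * K * (lam_init * sb * (Num.sqrt 6 * tau)).
  have lo0 : 0 < 64 * K ^+ 2 / eta by rewrite divr_gt0// mulr_gt0// exprn_gt0.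
  have lnps : ln (p - s)%N%:R <= ln p%:R :> R.
    rewrite ler_ln ?posrE ?ltr0n ?subn_gt0// ?ler_nat ?leq_subr//; last exact: ltnW.
    by rewrite (leq_trans _ sp)// mul2n -addnn -addn1 leq_add2l.
  have [lo hi] := tuning_ratio_bounds sigma0 lam0 nR0 lo0 (sqrtr_ge0 _)
    (erefl tau) lnp0 (ln_le_2ln_subn sp) lnps rat.
  split => //; apply: le_trans lo; apply: ler_wpM2r.
    by apply: mulr_ge0; [apply: mulr_ge0; [exact: ltW | exact: sqrtr_ge0] | exact: ltW].
  rewrite ler_pdivlMr// ler_piMr//; last exact: ltW.
  by rewrite mulr_ge0// sqr_ge0.
have Linit_t : is_lasso X (X *m beta + e) lam_init (beta_init t) by rewrite -HY.
have Lhat_t : is_wlasso X (X *m beta + e) (lambda_n t)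
    (adaptive_weight (beta_init t)) (beta_hat t) by rewrite -HY.
have rt_u : rtilde * u <= 1 / 32.
  move: rt_q; rewrite ler_pdivlMr; last by rewrite mulr_gt0// mulr_gt0// exprn_gt0.
  rewrite (_ : rtilde * _ * _ = 32 * (rtilde * u)); last by rewrite /u /q; ring.
  have := eta0; lra.
have rt_bm : rtilde * u <= beta_min beta / 32.
  have e1 : 0 < 1 - eta by rewrite subr_gt0.
  move: bm1; rewrite (_ : _ * 16 * u = 32 * (rtilde * u) / (1 - eta)); last first.
    by field; rewrite gt_eqF.
  rewrite ler_pdivrMr//; have := mulr_gt0 bm0 eta0; lra.
have bm_beta j : j \in S -> beta_min beta <= `|beta j ord0|.
  move=> jS; apply: ge_inf; last by exists j.
  by exists 0 => _ [k _ ->].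
have ls0 : 0 <= lam_init * sb by rewrite mulr_ge0 ?sqrtr_ge0// ltW.
apply: (adaptive_lasso_support n0 hRE K1 lam0 noise noiseW Linit_t Lhat_t r_rt
  rt_u bm_beta bm_u rt_bm).
- by rewrite mulr_gt0.
(* 60 = 10 * 6 comes from the noise level 6 * tau *)
- apply: le_trans mu_lo; rewrite -/sb -/s -/K.
  rewrite (_ : 10 * _ = 60 * (K ^+ 2 * (lam_init * sb * tau))); last ring.
  rewrite -[leRHS]mulrA; apply: ler_wpM2r; last by rewrite ler_nat.
  by rewrite mulr_ge0 ?sqr_ge0// mulr_ge0// ltW.
- rewrite -/sb -/s -/K -/q lam2.
  have s3 : 0 < Num.sqrt 3 :> R by rewrite sqrtr_gt0.
  rewrite -(ler_pM2l s3).
  rewrite (_ : _ * (_ * K * q) = Num.sqrt 3 * lambda_n t * (K * q)); last ring.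
  apply: (le_trans (ler_wpM2r (ltW (mulr_gt0 K0 q0)) mu_hi)).
  rewrite (_ : 16 * M * K * _ * _ =
    Num.sqrt 6 * tau * sb * (M * 16 * u)); last by rewrite /u; ring.
  rewrite (_ : _ * (_ * sb) =
    Num.sqrt 6 * tau * sb * (Num.sqrt 3 * beta_min beta)); last ring.
  apply: ler_wpM2l.
    apply: mulr_ge0; last exact: sqrtr_ge0.
    by apply: mulr_ge0; [exact: sqrtr_ge0 | exact: ltW].
  move: bm2; rewrite (_ : M / _ * 16 * u = M * 16 * u / Num.sqrt 3); last ring.
  by rewrite ler_pdivrMr// [leRHS]mulrC.
- rewrite -/s -/K -/q lam2.
  have lhs0 : 0 <= Num.sqrt 6 * tau * K * q.
    by do 3![apply: mulr_ge0; last exact: ltW]; exact: sqrtr_ge0.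
  rewrite -(@ler_pXn2r _ 2) ?nnegrE//.
  have s6 : Num.sqrt 6 ^+ 2 = 6 :> R by rewrite sqr_sqrtr.
  have q2 : q ^+ 2 = s%:R by rewrite sqr_sqrtr// ltW.
  have tau2 : tau ^+ 2 = sigma ^+ 2 * ln p%:R / n%:R.
    by rewrite exprMn sqr_sqrtr ?mulrA// divr_ge0// ltW.
  rewrite (_ : (_ * q) ^+ 2 = Num.sqrt 6 ^+ 2 * tau ^+ 2 * K ^+ 2 * q ^+ 2); last ring.
  move: s_small; rewrite ltr_pdivlMr; last by rewrite !mulr_gt0// exprn_gt0.
  rewrite s6 q2 tau2 => s_small.
  rewrite (_ : 6 * _ * _ * _ = 1 / 16 *
    (s%:R * (96 * sigma ^+ 2 * K ^+ 2 * ln p%:R) / n%:R)); last first.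
    by field; rewrite gt_eqF.
  rewrite (_ : (1 / 4) ^+ 2 = 1 / 16 * 1 :> R); last by field.
  by rewrite ler_pM2l// ler_pdivrMr// mul1r ltW.
Qed.
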